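(* Let $g:(0,\infty)\to(0,\infty)$ be a decreasing function satisfying one of: (a) $g$ varies regularly at infinity with index strictly less than $-2$; or (b) the function $u\mapsto u^2g(u)$ is monotone and has a finite limit as $u\to\infty$. Then: (1) If $\int_0^\infty u^{-1}\Lambda_g(u)\,du<\infty$ and $\Lambda_g$ is bounded from above, then there exists a constant $c>0$ such that $\mathbb P$-a.s. for all $n$ large enough $\lambda_1^{(n)}\ge c\,g(n)$. (2) If $\int_0^\infty u^{-1}\Lambda_g(u)\,du=\infty$, then $\mathbb P$-a.s. $\liminf_{n\to\infty}\lambda_1^{(n)}/g(n)=0$.
   Context: Let $d\ge 2$, $\mathfrak E_d$ the nearest-neighbour edges of $\mathbb Z^d$, $x\sim y$ if $|x-y|_1=1$. Conductances $(w_e)_{e\in\mathfrak E_d}$ are i.i.d. $(0,\infty)$-valued with law $\mathbb P$; $w$ denotes a generic copy. $B_n=[-n,n]^d\cap\mathbb Z^d$. $\mathcal E^{\boldsymbol w}(f)=\frac12\sum_{x}\sum_{y\sim x}w_{xy}(f(x)-f(y))^2$ and $\lambda_1^{(n)}=\inf\{\mathcal E^{\boldsymbol w}(f): f\in\ell^2(\mathbb Z^d)\text{ real},\ \mathrm{supp}\,f\subseteq B_n,\ \|f\|_2=1\}$ (principal Dirichlet eigenvalue in $B_n$ of $-\mathcal L_{\boldsymbol w}$, $(\mathcal L_{\boldsymbol w}f)(x)=\sum_{y\sim x}w_{xy}(f(y)-f(x))$). $\Lambda_g(u)=u^d\,\mathbb P[w\le g(u)]^{2d}$. Regular variation at infinity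 with index $\rho$: $g(u)=u^\rho L(u)$ with $L(Cu)/L(u)\to1$ as $u\to\infty$ for all $C>0$. *)

(* Defs.v *)
From HB Require Import structures.
From mathcomp Require Import all_boot all_order all_algebra.
From mathcomp Require Import all_classical all_reals all_analysis.
Set Implicit Arguments. Unset Strict Implicit. Unset Printing Implicit Defensive.
Import Order.TTheory GRing.Theory Num.Theory.
Import numFieldNormedType.Exports.
Local Open Scope classical_set_scope.
Local Open Scope ring_scope.

Definition vtx (d : nat) := {ffun 'I_d -> int}.

Definition vadd d (x y : vtx d) : vtx d := [ffun j => x j + y j].
Definition unitv d (i : 'I_d) : vtx d := [ffun j => ((i == j) : nat)%:Z].

Definition nbr d (x y : vtx d) : bool := (\sum_(j < d) `|x j - y j|)%N == 1%N.

(** Nearest-neighbour edges of Z^d: every edge {x,y} is uniquely written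
    {x, x + e_i} with i : 'I_d, encoded by the pair (x, i). *)
Definition edge (d : nat) := (vtx d * 'I_d)%type.

(** Points of the box B_n = [-n,n]^d ∩ Z^d, enumerated without repetition. *)
Definition box d (n : nat) : seq (vtx d) :=
  [seq [ffun j => (k j : nat)%:Z - n%:Z] | k : {ffun 'I_d -> 'I_(n.*2.+1)}].

Definition in_box d (n : nat) (x : vtx d) : bool :=
  [forall j, (- n%:Z <= x j) && (x j <= n%:Z)].

Section Dirichlet.
Variables (R : realType) (d : nat).

(** The conductance w_{xy} of the edge {x,y} (0 if x,y are not neighbours). *)
Definition cond (w : edge d -> R) (x y : vtx d) : R :=
  \sum_(i < d) (((y == vadd x (unitv i)) : nat)%:R * w (x, i)
               + ((x == vadd y (unitv i)) : nat)%:R * w (y, i)).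

(** Dirichlet form (1/2) sum_x sum_{y ~ x} w_xy (f x - f y)^2, for f supported
    in B_n: only x in B_{n+1} can contribute, and their neighbours lie in
    B_{n+2}. *)
Definition energy (w : edge d -> R) (n : nat) (f : vtx d -> R) : R :=
  2^-1 * \sum_(x <- box d n.+1) \sum_(y <- box d n.+2 | nbr x y)
           cond w x y * (f x - f y) ^+ 2.

Definition lambda1 (w : edge d -> R) (n : nat) : R :=
  inf [set energy w n f | f in
        [set f : vtx d -> R | (forall x, ~~ in_box n x -> f x = 0)
                            /\ \sum_(x <- box d n) f x ^+ 2 = 1]].

(** Lambda_g(u) = u^d P[w <= g(u)]^{2d}, with mu the law of a conductance *)
Definition Lambda (mu : probability R R) (g : R -> R) (u : R) : R :=
  u ^+ d * (fine (mu `]-oo, g u]%classic)) ^+ (2 * d).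

End Dirichlet.

Section Prob.
Context {R : realType} {dT : measure_display} {T : measurableType dT}.

Definition mutually_independent (P : probability T R) (I : eqType)
    (X : I -> T -> R) : Prop :=
  forall (s : seq I) (B : I -> set R), uniq s -> (forall i, measurable (B i)) ->
    P (\bigcap_(i in [set` s]) (X i @^-1` B i)) =
    (\prod_(i <- s) P (X i @^-1` B i))%E.
End Prob.

Definition regularly_varying {R : realType} (g : R -> R) (rho : R) : Prop :=
  exists L : R -> R, (forall u, 0 < u -> g u = u `^ rho * L u) /\
    forall C : R, 0 < C -> (fun u => L (C * u) / L u) x @[x --> +oo] --> (1 : R).

Definition monotone_on_pos {R : realType} (h : R -> R) : Prop :=
  (forall u v, 0 < u -> u <= v -> h u <= h v) \/
  (forall u v, 0 < u -> u <= v -> h v <= h u).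

(* Main.v *)
(** Only one consequence of the assumptions on [g] matters: [v^2 g(v) <= C u^2 g(u)]
    for large [u <= v].

    Lower bound.  Let [N = 2^(k+1)] and call an edge [a]-closed if its conductance
    is at most [a].  The edge boundary of a set of vertices is a closed mod-2
    cochain, hence splits into *-connected pieces that are boundaries themselves,
    and a *-connected set of [m] edges in [B_N] is one of at most [N^d C^m] lattice
    animals.  Take a small constant [xi], [t = g(2^(k/2))] and [s = g(2^k)].  Union
    bounds show that, off events of summable probability, *-connected boundaries
    with at least [(d+1)k] edges are at least half [xi]-open, [t]-closed *-connected
    boundaries have bounded size, and every vertex of [B_N] escapes from [B_N]
    through [s]-open edges.  So every [x] is attached, by boundedly many [s]-open
    steps followed by polylogarithmically many [t]-open steps, to a point [z x] of
    the [xi]-open cluster of the complement of [B_N].  An isoperimetric inequality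
    for this cluster, with each vertex weighted by the number of [x] attached to it,
    and Cheeger's argument bound the sum of [f(z x)^2] by [C N^2] times the energy,
    while the increments [f(x) - f(z x)] cost at most [C / s + polylog(N) / t].  By
    the growth bound on [g], [N^2] and [polylog(N) / t] are [O(1 / s)].

    Upper bound.  Vertices with even coordinates have disjoint stars, so by
    independence there are almost surely infinitely many scales at which some star
    has all its conductances below [eps g]; test with the indicator of its centre. *)

Require Import Defs.
From HB Require Import structures.
From mathcomp Require Import all_boot all_order all_algebra.
From mathcomp Require Import all_classical all_reals all_analysis.
From mathcomp Require Import measurable_realfun.
From mathcomp Require Import zify ring lra.
Set Implicit Arguments.
Unset Strict Implicit.
Unset Printing Implicit Defensive.
Import Order.TTheory GRing.Theory Num.Theory.
Import numFieldNormedType.Exports.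
Local Open Scope classical_set_scope.
Local Open Scope ring_scope.

(** * Counting and sums over lists *)

Lemma count_le_sum (T I : eqType) (s : seq T) (r : seq I) (A : T -> bool) (B : I -> T -> bool) :
  (forall x, x \in s -> A x -> exists2 i, i \in r & B i x) ->
  (count A s <= \sum_(i <- r) count (B i) s)%N.
Proof.
elim: s => [|x s IH] h; first by [].
rewrite /= big_split /= leq_add //; last by apply: IH => y ys; apply: h; rewrite inE ys orbT.
case Ax: (A x) => //; have [|i ir Bi] := h x _ Ax; first by rewrite mem_head.
by rewrite (big_rem i) //= Bi.
Qed.

Lemma seq_argmin (R : realType) (T : eqType) (h : T -> R) (s : seq T) x0 : x0 \in s ->
  exists2 x, x \in s & forall y, y \in s -> h x <= h y.
Proof.
elim: s x0 => // a s IH x0 _; case: s IH => [|b s] IH.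
  by exists a; rewrite ?mem_head // => y; rewrite inE => /eqP->.
have [|x xs hx] := IH b; first by rewrite mem_head.
have [ax|xa] := leP (h a) (h x).
  exists a; rewrite ?mem_head // => y; rewrite inE => /orP[/eqP->//|/hx].
  exact: le_trans.
exists x; first by rewrite inE xs orbT.
by move=> y; rewrite inE => /orP[/eqP->|/hx//]; apply: ltW.
Qed.

Lemma ler_sum_sub (R : realType) (T : eqType) (h : T -> R) (s1 s2 : seq T) :
  uniq s1 -> uniq s2 -> {subset s1 <= s2} -> (forall x, 0 <= h x) ->
  \sum_(x <- s1) h x <= \sum_(x <- s2) h x.
Proof.
move=> u1 u2 s12 h0; rewrite [leRHS](bigID (mem s1)) /= -[X in _ <= X + _]big_filter.
rewrite [X in _ <= X + _](perm_big s1) /=; first by rewrite lerDl sumr_ge0.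
apply: uniq_perm => //; first by rewrite filter_uniq.
by move=> x; rewrite mem_filter; apply/andb_idr/s12.
Qed.

(** * Boxes, edges and edge boundaries *)

Section Lattice.
Variable d : nat.
Implicit Types (x y : vtx d) (i j : 'I_d) (e : edge d) (N : nat).
Implicit Types (S : vtx d -> bool).

Definition stp x i (k : int) : vtx d :=
  [ffun j => x j + ((i == j) : nat)%:Z * k].

Lemma stpE x i k j : stp x i k j = x j + ((i == j) : nat)%:Z * k.
Proof. by rewrite ffunE. Qed.

Lemma stp0 x i : stp x i 0 = x.
Proof. by apply/ffunP => j; rewrite stpE mulr0 addr0. Qed.

Lemma stpD x i k l : stp (stp x i k) i l = stp x i (k + l).
Proof. by apply/ffunP => j; rewrite !stpE mulrDr addrA. Qed.

Lemma stpC x i j k l : stp (stp x i k) j l = stp (stp x j l) i k.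
Proof. by apply/ffunP => m; rewrite !stpE addrAC. Qed.

Lemma vadd_unitv x i : vadd x (unitv i) = stp x i 1.
Proof. by apply/ffunP => j; rewrite !ffunE mulr1. Qed.

Lemma in_boxP N x :
  reflect (forall j, - N%:Z <= x j <= N%:Z) (in_box N x).
Proof. exact: forallP. Qed.

Lemma mem_box N x : (x \in box d N) = in_box N x.
Proof.
apply/idP/in_boxP.
  by case/mapP => k _ -> j; rewrite ffunE; have := ltn_ord (k j); set a := nat_of_ord _; move=> ?; apply/andP; split; lia.
move=> h; apply/mapP; exists [ffun j => inord (absz (x j + N%:Z))].
  by rewrite mem_enum.
apply/ffunP => j; rewrite !ffunE.
have /andP[h1 h2] := h j; rewrite inordK; last by lia.
by rewrite gez0_abs ?addrK //; lia.
Qed.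

Lemma box_uniq N : uniq (box d N).
Proof.
rewrite map_inj_uniq ?enum_uniq // => k l /ffunP kl.
apply/ffunP => j; apply: val_inj; have := kl j; rewrite !ffunE /=; lia.
Qed.

Lemma size_box N : size (box d N) = (N.*2.+1 ^ d)%N.
Proof. by rewrite size_map -cardE card_ffun !card_ord. Qed.

Lemma in_box_le N M x : (N <= M)%N -> in_box N x -> in_box M x.
Proof. by move=> NM /in_boxP h; apply/in_boxP => j; have := h j; lia. Qed.

(** Contains all edges with at least one endpoint in [B_N]. *)
Definition EB N : seq (edge d) := [seq (x, i) | x <- box d N.+1, i <- enum 'I_d].

Lemma mem_EB N e : (e \in EB N) = in_box N.+1 e.1.
Proof.
case: e => x i /=; apply/allpairsP/idP => [[[y j] [/= + _ [-> _]]]|xB].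
  by rewrite mem_box.
by exists (x, i); split; rewrite //= ?mem_box ?mem_enum.
Qed.

Lemma EB_uniq N : uniq (EB N).
Proof.
by apply: allpairs_uniq; rewrite ?box_uniq ?enum_uniq // => -[? ?] [? ?] _ _.
Qed.

Lemma size_EB N : size (EB N) = (N.+1.*2.+1 ^ d * d)%N.
Proof. by rewrite size_allpairs size_box size_enum_ord. Qed.

Lemma in_box_stp N x i : in_box N x \/ in_box N (stp x i 1) -> in_box N.+1 x.
Proof.
move=> h; apply/in_boxP => j.
case: h => /in_boxP/(_ j); rewrite ?stpE; case: (i == j); lia.
Qed.

(** The mod-2 coboundary of the indicator of [S]: exclusive or makes it additive under symmetric
    difference. *)
Definition bd (S : vtx d -> bool) e : bool := S e.1 (+) S (stp e.1 e.2 1).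

Definition inside N (S : vtx d -> bool) := forall x, S x -> in_box N x.

Lemma bd_touch N S e : inside N S -> bd S e ->
  in_box N e.1 \/ in_box N (stp e.1 e.2 1).
Proof.
move=> SN; rewrite /bd; case E: (S e.1); first by left; apply: SN.
by move=> /= /SN; right.
Qed.

Lemma bd_EB N S e : inside N S -> bd S e -> e \in EB N.
Proof. by rewrite mem_EB => SN /(bd_touch SN); apply: in_box_stp. Qed.

Lemma telescope_addb (a : nat -> bool) K :
  \big[addb/false]_(0 <= k < K) (a k (+) a k.+1) = a 0%N (+) a K.
Proof.
elim: K => [|K IH]; first by rewrite big_geq // addbb.
by rewrite big_nat_recr //= IH addbA addbK.
Qed.

(* A compactly supported closed mod-2 cochain is a coboundary: integrate it
   along the rays in direction [e_0]; in dimension at least two the resulting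
   potential has compact support too. *)
Lemma cochain_exact N (c : edge d -> bool) : (1 < d)%N ->
  (forall x i, c (x, i) -> in_box N x \/ in_box N (stp x i 1)) ->
  (forall x i j, c (x, i) (+) c (stp x i 1, j) (+) (c (x, j) (+) c (stp x j 1, i))
                 = false) ->
  exists T : vtx d -> bool, inside N T /\ forall e, bd T e = c e.
Proof.
move=> d2 csupp cl.
pose i0 : 'I_d := Ordinal (ltnW d2); pose i1 : 'I_d := Ordinal d2.
have i01 : (i0 == i1) = false by [].
have i10 : (i1 == i0) = false by [].
(* This many steps carry any point whose [i0]-coordinate is at least [-N-1] past the box. *)
pose K := N.*2.+3.
pose H x := \big[addb/false]_(0 <= k < K) c (stp x i0 k%:Z, i0).
have cout x i : ~~ in_box N x -> ~~ in_box N (stp x i 1) -> c (x, i) = false.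
  by move=> h1 h2; apply/negbTE/negP => /csupp [h|h]; [case/negP: h1|case/negP: h2].
have outj x (j : 'I_d) : ~~ (- N%:Z <= x j <= N%:Z) -> ~~ in_box N x.
  by move=> h; apply/negP => /in_boxP/(_ j); apply/negP.
(* Parallel rays bound a strip of plaquettes; closedness makes the difference of the two integrals
   telescope to the ends of the strip, and the far end lies off the support. *)
have fact1 x j : - N%:Z - 1 <= x i0 -> H x (+) H (stp x j 1) = c (x, j).
  move=> xi0; rewrite /H -big_split /=.
  rewrite (eq_bigr (fun k : nat => c (stp x i0 k%:Z, j) (+) c (stp x i0 k.+1%:Z, j))).
    rewrite (telescope_addb (fun k => c (stp x i0 k%:Z, j))) stp0.
    rewrite (cout (stp x i0 _)) ?addbF //; apply: (outj _ i0);
      rewrite !stpE eqxx /K; case: (i0 == j) (j == i0) => -[]; lia.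
  move=> k _; have := cl (stp x i0 k%:Z) i0 j.
  rewrite stpD (stpC x j i0) (_ : k%:Z + 1 = k.+1); last by lia.
  by do 4!case: (c _).
have factA x j : j != i0 -> ~~ (- N%:Z <= x j <= N%:Z) -> H x = false.
  move=> ji h; rewrite /H big1 // => k _; apply: cout; apply: (outj _ j);
    by rewrite !stpE eq_sym (negbTE ji) !mul0r !addr0.
have factB x : N%:Z < x i0 -> H x = false.
  move=> h; rewrite /H big1 // => k _; apply: cout; apply: (outj _ i0);
    rewrite !stpE eqxx; lia.
(* On the layer just below the box no edge in direction [i1] carries [c], so [H] is constant along
   [i1], and beyond the box it vanishes. This needs a second direction. *)
have factC x : - N%:Z - 1 <= x i0 -> x i0 < - N%:Z -> H x = false.
  move=> h0 h1.
  have shift k : H x = H (stp x i1 k%:Z).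
    elim: k => [|k ->]; first by rewrite stp0.
    have := fact1 (stp x i1 k%:Z) i1; rewrite stpD cout; last 2 first.
    - by apply: (outj _ i0); rewrite !stpE i10; lia.
    - by apply: (outj _ i0); rewrite !stpE i10; lia.
    rewrite (_ : k%:Z + 1 = k.+1); last by lia.
    have h : - N%:Z - 1 <= stp x i1 k%:Z i0 by rewrite !stpE i10; lia.
    by move=> /(_ h); case: (H _); case: (H _).
  have [h|h] := boolP (- N%:Z <= x i1 <= N%:Z); last by apply: factA h.
  rewrite (shift N.*2.+1); apply: (factA _ i1) => //; rewrite !stpE eqxx; lia.
have fact2 x : - N%:Z - 1 <= x i0 -> ~~ in_box N x -> H x = false.
  move=> h0 /forallPn[j hj]; have [ji|ji] := eqVneq j i0; last exact: factA hj.
  rewrite ji in hj; have [h|h] := ltP (x i0) (- N%:Z); first exact: factC.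
  by apply: factB; move: hj; rewrite h /= -ltNge.
(* An edge meeting the box starts at height at least [-N-1], where [H] already vanishes outside the
   box, so the cut-off does not change the coboundary. *)
exists (fun x => in_box N x && H x); split=> [x /andP[]//|[x j]].
rewrite /bd /=; case xB: (in_box N x) => /=.
  have x0 : - N%:Z - 1 <= x i0 by have/in_boxP/(_ i0) := xB; lia.
  rewrite -(fact1 _ j x0); case xB': (in_box N (stp x j 1)) => //=.
  rewrite (fact2 (stp x j 1)) ?xB' // stpE; case: (j == i0); lia.
case xB': (in_box N (stp x j 1)) => /=; last by rewrite cout ?xB ?xB'.
have x0 : - N%:Z - 1 <= x i0.
  by have/in_boxP/(_ i0) := xB'; rewrite stpE; case: (j == i0); lia.
by rewrite -(fact1 _ j x0) (fact2 x) ?xB.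
Qed.

(** Sup-norm closeness of base points, whatever the directions; any two edges of a plaquette are
    adjacent in this sense. *)
Definition adj e e' : bool := [forall j, `|e.1 j - e'.1 j| <= 1].

Lemma adj_refl e : adj e e.
Proof. by apply/forallP => j; rewrite subrr normr0. Qed.

Lemma adj_sym e e' : adj e e' = adj e' e.
Proof. by apply: eq_forallb => j; rewrite distrC. Qed.

(** The [b]s mark the boundary edges of a plaquette, the [q]s a class of edges. All marked edges
    agree on the class, so selecting it keeps all of them or none, and the parity stays even. *)
Lemma plaquette_even (b1 b2 b3 b4 q1 q2 q3 q4 : bool) :
  b1 (+) b2 (+) (b3 (+) b4) = false ->
  b1 ==> b2 ==> (q1 == q2) -> b1 ==> b3 ==> (q1 == q3) ->
  b1 ==> b4 ==> (q1 == q4) -> b2 ==> b3 ==> (q2 == q3) ->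
  b2 ==> b4 ==> (q2 == q4) -> b3 ==> b4 ==> (q3 == q4) ->
  (b1 && q1) (+) (b2 && q2) (+) ((b3 && q3) (+) (b4 && q4)) = false.
Proof. by case: b1 b2 b3 b4 q1 q2 q3 q4 => -[] [] [] [] [] [] []. Qed.

(** Connectedness of the boundary under [adj], in induction form. *)
Definition starconn (S : vtx d -> bool) := forall Q : edge d -> bool,
  (exists2 e, bd S e & Q e) ->
  (forall e e', bd S e -> Q e -> bd S e' -> adj e e' -> Q e') ->
  forall e, bd S e -> Q e.

(** A class [Q] witnessing disconnection cuts out a cochain that is still closed; [cochain_exact]
    integrates it to [T1], and [T2] is its symmetric difference with [S]. *)
Lemma starconn_split N S : (1 < d)%N -> inside N S -> ~ starconn S ->
  exists T1 T2, [/\ inside N T1, inside N T2, forall x, S x = T1 x (+) T2 x &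
    [/\ forall e, bd S e = bd T1 e || bd T2 e, forall e, ~~ (bd T1 e && bd T2 e),
      exists e, bd T1 e & exists e, bd T2 e]].
Proof.
move=> d2 SN /existsNP[Q]; move=> /not_implyP[[e0 Se0 Qe0]] /not_implyP[Qcl].
move=> /existsNP[e1 /not_implyP[Se1 /negP Qe1]].
have [||T [TN TE]] := @cochain_exact N (fun e => bd S e && Q e) d2.
- by move=> x i /andP[h _]; apply: (bd_touch SN h).
- move=> x i j.
  have near0 z k l : adj (z, k) (z, l) by apply/forallP => m; rewrite subrr normr0.
  have near1 z a k l : adj (z, k) (stp z a 1, l).
    by apply/forallP => m; rewrite /= stpE; case: (a == m); lia.
  have near2 z a b k l : adj (stp z a 1, k) (stp z b 1, l).
    by apply/forallP => m; rewrite /= !stpE; case: (a == m); case: (b == m); lia.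
  have QE e e' : adj e e' -> bd S e -> bd S e' -> Q e = Q e'.
    move=> ee' h h'; apply/idP/idP => q; first exact: (Qcl e).
    by apply: (Qcl e') => //; rewrite adj_sym.
  have QB e e' : adj e e' -> bd S e ==> bd S e' ==> (Q e == Q e').
    by move=> ee'; apply/implyP => h; apply/implyP => h'; apply/eqP/QE.
  apply: plaquette_even; rewrite ?QB ?(adj_sym _ (x, j)) ?near0 ?near1 ?near2 //.
  by rewrite /bd /= (stpC x j i); case: (S x); case: (S (stp x i 1));
    case: (S (stp x j 1)); case: (S (stp (stp x i 1) j 1)).
have bdE e : bd (fun x => S x (+) T x) e = bd S e && ~~ Q e.
  have := TE e; rewrite /bd /=; by case: (S _); case: (S _); case: (T _); case: (T _); case: (Q e).
exists T, (fun x => S x (+) T x); split=> //.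
- by move=> x; case h: (S x); [move=> _; apply: SN|move=> /= /TN].
- by move=> x; case: (S x); case: (T x).
split.
- by move=> e; rewrite bdE TE; case: (bd S e); case: (Q e).
- by move=> e; rewrite bdE TE; case: (bd S e); case: (Q e).
- by exists e0; rewrite TE Se0.
- by exists e1; rewrite bdE Se1.
Qed.

Definition nbd N (S : vtx d -> bool) := count (bd S) (EB N).

(** Induction on the number of boundary edges: a split produces two nonempty disjoint parts, so both
    are smaller. *)
Lemma starconn_ind N (Q : (vtx d -> bool) -> Prop) : (1 < d)%N ->
  (forall S, inside N S -> starconn S -> Q S) ->
  (forall S T1 T2, inside N T1 -> inside N T2 ->
     (forall x, S x = T1 x (+) T2 x) -> (forall e, bd S e = bd T1 e || bd T2 e) ->
     (forall e, ~~ (bd T1 e && bd T2 e)) -> Q T1 -> Q T2 -> Q S) ->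
  forall S, inside N S -> Q S.
Proof.
move=> d2 Qc Qs S; move: {2}(nbd N S) (leqnn (nbd N S)) => n.
elim: n S => [|n IH] S nS SN; have [Sc|/(starconn_split d2 SN)] := pselect (starconn S);
  try exact: Qc.
  move=> [T1 [T2 [T1N T2N ST [bE _ [e he] _]]]]; move: nS.
  rewrite leqn0 => /eqP/eqP; rewrite -[_ == _]negbK -lt0n -has_count => /hasPn/(_ e).
  by rewrite bE he => /(_ (bd_EB T1N he)).
move=> [T1 [T2 [T1N T2N ST [bE bN [e1 h1] [e2 h2]]]]].
have cnt : nbd N S = (nbd N T1 + nbd N T2)%N.
  rewrite /nbd -(count_predUI (bd T1)).
  rewrite [X in (_ + X)%N](@eq_count _ _ pred0) ?count_pred0 ?addn0.
    by apply: eq_count => e; rewrite bE.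
  by move=> e /=; apply/negbTE/bN.
have p1 : (0 < nbd N T1)%N by rewrite -has_count; apply/hasP; exists e1; rewrite ?(bd_EB T1N).
have p2 : (0 < nbd N T2)%N by rewrite -has_count; apply/hasP; exists e2; rewrite ?(bd_EB T2N).
by apply: (Qs S T1 T2) => //; apply: IH => //; lia.
Qed.

Lemma exit_up S x i n : S x -> ~~ S (stp x i n%:Z) ->
  exists2 k : nat, (k < n)%N & bd S (stp x i k%:Z, i).
Proof.
elim: n => [|n IH] Sx; first by rewrite stp0 Sx.
move=> Sn; have [h|h] := boolP (S (stp x i n%:Z)).
  exists n => //; rewrite /bd /= stpD h (_ : n%:Z + 1 = n.+1); last by lia.
  by rewrite (negbTE Sn).
by have [k kn hk] := IH Sx h; exists k => //; apply: leqW.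
Qed.

Lemma exit_down S x i n : S x -> ~~ S (stp x i (- n%:Z)) ->
  exists2 k : nat, (k < n)%N & bd S (stp x i (- k%:Z - 1), i).
Proof.
elim: n => [|n IH] Sx; first by rewrite oppr0 stp0 Sx.
move=> Sn; have [h|h] := boolP (S (stp x i (- n%:Z))).
  exists n => //; rewrite /bd /= stpD subrK h (_ : - n%:Z - 1 = - n.+1%:Z); last by lia.
  by rewrite (negbTE Sn).
by have [k kn hk] := IH Sx h; exists k => //; apply: leqW.
Qed.

Lemma inside_out N S x i (k : int) : inside N S -> in_box N x ->
  N.*2%:Z < k \/ k < - N.*2%:Z -> ~~ S (stp x i k).
Proof.
move=> SN /in_boxP/(_ i) xB hk; apply/negP => /SN/in_boxP/(_ i).
by rewrite stpE eqxx; lia.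
Qed.

Lemma inside_exit_up N S x i : inside N S -> S x ->
  exists2 k : nat, (k < N.*2.+1)%N & bd S (stp x i k%:Z, i).
Proof.
move=> SN Sx; apply: exit_up => //; apply: (inside_out _ SN) (SN _ Sx) _.
by left; lia.
Qed.

Lemma inside_exit_down N S x i : inside N S -> S x ->
  exists k : nat, bd S (stp x i (- k%:Z - 1), i).
Proof.
move=> SN Sx; have [] := @exit_down S x i N.*2.+1 Sx; last by move=> k _; exists k.
by apply: (inside_out _ SN) (SN _ Sx) _; right; lia.
Qed.

Lemma mem_bdEB N S e : inside N S -> (e \in [seq e <- EB N | bd S e]) = bd S e.
Proof.
by move=> SN; rewrite mem_filter andb_idr // => /(bd_EB SN).
Qed.

(** Send a vertex of [S] to an edge where its ray in direction [i0] leaves [S], with the number of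
    steps taken, at most [2N]; this pair determines the vertex. *)
Lemma volume_le_width N S : (0 < d)%N -> inside N S ->
  (count S (box d N) <= N.*2.+1 * nbd N S)%N.
Proof.
move=> d0 SN; pose i0 : 'I_d := Ordinal d0.
have [F FP] : exists F : vtx d -> edge d * nat, forall x, S x ->
    [/\ bd S (F x).1, ((F x).2 < N.*2.+1)%N & (F x).1 = (stp x i0 (F x).2%:Z, i0)].
  have [|F FP] := @choice _ _ (fun x F => S x -> [/\ bd S F.1, (F.2 < N.*2.+1)%N & F.1 = (stp x i0 F.2%:Z, i0)]); last by exists F.
  move=> x; have [Sx|nSx] := pselect (S x).
    have [k kN hk] := inside_exit_up i0 SN Sx.
    by exists ((stp x i0 k%:Z, i0), k).
  by exists ((x, i0), 0%N).
rewrite -size_filter -(size_map F) /nbd -size_filter mulnC -{1}(size_iota 0 N.*2.+1).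
rewrite -(size_allpairs pair).
apply: uniq_leq_size.
  rewrite map_inj_in_uniq ?filter_uniq ?box_uniq // => x y.
  rewrite !mem_filter => /andP[/FP[_ _ Fx] _] /andP[/FP[_ _ Fy] _] Fxy.
  move: Fx; rewrite Fxy Fy => -[] /(congr1 (fun z => stp z i0 (- (F y).2%:Z))).
  by rewrite !stpD subrr !stp0.
move=> p /mapP[x]; rewrite mem_filter => /andP[/FP[h1 h2 _] _] ->.
by rewrite [F x]surjective_pairing allpairs_f // ?mem_bdEB // mem_iota.
Qed.

(** A bound free of [N]: leaving [S] along a direction other than [i] finds a boundary edge whose
    base point has the same [i]-th coordinate, so [d] boundary edges encode a vertex. *)
Lemma volume_le_pow N S : (1 < d)%N -> inside N S ->
  (count S (box d N) <= (nbd N S).+1 ^ d)%N.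
Proof.
move=> d2 SN; pose e0 : edge d := ([ffun => 0], Ordinal d2).
set B := [seq e <- EB N | bd S e].
have [F FP] : exists F : vtx d -> {ffun 'I_d -> 'I_(size B).+1}, forall x, S x ->
    forall i, (nth e0 B (F x i)).1 i = x i.
  have [|F FP] := @choice _ _ (fun x (F : {ffun 'I_d -> 'I_(size B).+1}) =>
    S x -> forall i, (nth e0 B (F i)).1 i = x i); last by exists F.
  move=> x; have [Sx|nSx] := pselect (S x); last by exists [ffun => ord0].
  have /choice[h hP] : forall i, exists k : 'I_(size B).+1, (nth e0 B k).1 i = x i.
    move=> i; have [j ji] : exists j : 'I_d, j != i.
      have [->|ni] := eqVneq i (Ordinal (ltnW d2)); last by exists (Ordinal (ltnW d2)); rewrite eq_sym.
      by exists (Ordinal d2).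
    have [k _ hk] := inside_exit_up j SN Sx.
    have eB : (stp x j k%:Z, j) \in B by rewrite mem_bdEB.
    exists (inord (index (stp x j k%:Z, j) B)).
    rewrite inordK ?nth_index //=; last by rewrite ltnS index_size.
    by rewrite stpE (negbTE ji) mul0r addr0.
  by exists (finfun h) => _ i; rewrite ffunE.
rewrite -size_filter -(size_map F) /nbd -size_filter -/B.
have -> : ((size B).+1 ^ d)%N = #|{ffun 'I_d -> 'I_(size B).+1}|.
  by rewrite card_ffun !card_ord.
rewrite cardE; apply: uniq_leq_size => [|f _]; last by rewrite mem_enum.
rewrite map_inj_in_uniq ?filter_uniq ?box_uniq // => x y.
rewrite !mem_filter => /andP[/FP Fx _] /andP[/FP Fy _] Fxy.
by apply/ffunP => i; rewrite -Fx -Fy Fxy.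
Qed.

(** Each of the [2d] rays from [x] leaves [S]; the sign of the displacement separates the two exits
    on one axis. *)
Lemma bd_ge_star N S x : inside N S -> S x -> (2 * d <= nbd N S)%N.
Proof.
move=> SN Sx.
have ex (p : 'I_d * bool) : exists k : int, (0 <= k) = p.2 /\ bd S (stp x p.1 k, p.1).
  case: p => i [] /=.
    by have [k _ hk] := inside_exit_up i SN Sx; exists k%:Z.
  have [k hk] := inside_exit_down i SN Sx; exists (- k%:Z - 1); split => //.
  by apply/negbTE; rewrite -ltNge; lia.
have /choice[kx kxP] := ex.
pose L : seq (edge d) := [seq (stp x p.1 (kx p), p.1) | p : 'I_d * bool].
have -> : (2 * d)%N = size L.
  by rewrite size_map -cardE card_prod card_ord card_bool mulnC.
rewrite /nbd -size_filter; apply: uniq_leq_size; last first.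
  by move=> e /mapP[p _ ->]; rewrite mem_bdEB //; case: (kxP p).
rewrite map_inj_uniq ?enum_uniq // => p q [] + pq; rewrite -pq => /ffunP/(_ p.1).
rewrite !stpE eqxx !mul1r => /addrI kpq.
case: (kxP p) (kxP q) => [hp _] [hq _]; move: hp hq; rewrite kpq => -> e2.
by case: p q pq e2 {kpq} => [a b] [a' b'] /= -> ->.
Qed.

(** * Lattice animals *)

(** Exploration by a walk: each new edge costs a detour of two steps. Connected sets may branch;
    walks are easy to count. *)
Lemma grow N S e0 n : inside N S -> starconn S -> bd S e0 -> (n < nbd N S)%N ->
  exists p (U : seq (edge d)), [/\ path adj e0 p, size p = n.*2, all (bd S) (e0 :: p) &
    [/\ uniq U, {subset U <= e0 :: p} & (n < size U)%N]].
Proof.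
move=> SN Sc Se0; elim: n => [|n IH] nS.
  by exists [::], [:: e0]; split; rewrite //= ?Se0 //; split.
have [p [U [pp sp bp [Uu Up nU]]]] := IH (ltnW nS).
have [all_in|] := pselect (forall e, bd S e -> e \in e0 :: p).
  (* Everything is already visited: the walk stands still for two steps. *)
  exists (p ++ [:: last e0 p; last e0 p]), [seq e <- EB N | bd S e]; split.
  - by rewrite cat_path pp /= adj_refl.
  - by rewrite size_cat sp /= addn2.
  - rewrite -cat_cons all_cat bp /= andbT andbb.
    by move: bp => /allP; apply; rewrite mem_last.
  split; rewrite ?filter_uniq ?EB_uniq ?size_filter // => e.
  by rewrite mem_filter -cat_cons mem_cat => /andP[/all_in ->].
move=> /existsNP[e' /not_implyP[Se' e'p]].
have : ~ (forall e e'', bd S e -> e \in e0 :: p -> bd S e'' -> adj e e'' -> e'' \in e0 :: p).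
  move=> h; apply: e'p; apply: (Sc (fun e => e \in e0 :: p)) => //.
  by exists e0 => //; rewrite mem_head.
move=> /existsNP[e1 /existsNP[e2]] /not_implyP[S1] /not_implyP[e1p].
move=> /not_implyP[S2] /not_implyP[a12] /negP e2p.
move: e1p pp sp bp Up e2p => /splitPl[p1 p2 e1E].
rewrite cat_path e1E => /andP[pp1 pp2] sp bp Up e2p.
(* Insert the excursion from [e1] to its unvisited neighbour [e2] and back. *)
exists (p1 ++ [:: e2, e1 & p2]), (e2 :: U); split.
- by rewrite cat_path e1E pp1 /= a12 adj_sym a12 pp2.
- by move: sp; rewrite !size_cat /= !addnS doubleS => ->.
- by move: bp; rewrite -!cat_cons !all_cat /= S1 S2.
split=> //=.
  by rewrite Uu andbT; apply: contra e2p; apply: Up.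
move=> e; rewrite -cat_cons mem_cat !inE => /orP[->|/Up].
  by rewrite !orbT.
by rewrite -cat_cons mem_cat inE => /orP[->|->]; rewrite ?orbT.
Qed.

Definition nbrs e : seq (edge d) :=
  [seq (vadd e.1 v, i) | v <- box d 1, i <- enum 'I_d].

Lemma mem_nbrs e e' : adj e e' -> e' \in nbrs e.
Proof.
move=> /forallP a; apply/allpairsP.
exists ([ffun j => e'.1 j - e.1 j], e'.2); split; rewrite ?mem_enum //=.
  by rewrite mem_box; apply/in_boxP => j; rewrite ffunE; have := a j; lia.
case: e' {a} => y i /=; congr pair; apply/ffunP => j; rewrite !ffunE.
by rewrite addrC subrK.
Qed.

Lemma size_nbrs e : size (nbrs e) = (3 ^ d * d)%N.
Proof. by rewrite size_allpairs size_box size_enum_ord. Qed.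

Fixpoint paths n e : seq (seq (edge d)) :=
  if n is n'.+1 then flatten [seq [seq e' :: p | p <- paths n' e'] | e' <- nbrs e]
  else [:: [::]].

Lemma mem_paths e p : path adj e p -> p \in paths (size p) e.
Proof.
elim: p e => [|e' p IH] e /=; first by rewrite inE.
move=> /andP[ee' /IH h]; apply/flattenP.
exists [seq e' :: p | p <- paths (size p) e'].
  by apply/mapP; exists e' => //; apply: mem_nbrs.
by apply/mapP; exists p.
Qed.

Lemma size_paths n e : size (paths n e) = ((3 ^ d * d) ^ n)%N.
Proof.
elim: n e => [|n IH] e //=; rewrite size_flatten /shape -map_comp sumnE big_map.
rewrite (eq_bigr (fun=> ((3 ^ d * d) ^ n)%N)); last by move=> e' _ /=; rewrite size_map.
by rewrite big_const_seq count_predT iter_addn_0 size_nbrs expnS mulnC.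
Qed.

(** Duplicate-free lists of [v] edges taken from adjacency paths of
    [2 m - 1] edges that start in [B_N]. *)
Definition animals N m v : seq (seq (edge d)) :=
  [seq V <- [seq mask (b : (m.*2.-1).-tuple bool) q |
     q <- flatten [seq [seq e0 :: p | p <- paths m.-1.*2 e0] | e0 <- EB N],
     b <- enum {: (m.*2.-1).-tuple bool}] | uniq V && (size V == v)].

Lemma size_animals N m v : (size (animals N m v) <=
   size (EB N) * (3 ^ d * d) ^ (m.-1.*2) * 2 ^ (m.*2.-1))%N.
Proof.
rewrite size_filter; apply: leq_trans (count_size _ _) _.
rewrite size_allpairs -cardE card_tuple card_bool leq_mul2r size_flatten /shape.
rewrite -map_comp sumnE big_map.
rewrite (eq_bigr (fun=> ((3 ^ d * d) ^ (m.-1.*2))%N)); last first.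
  by move=> e' _ /=; rewrite size_map size_paths.
by rewrite big_const_seq count_predT iter_addn_0 mulnC leqnn orbT.
Qed.

Lemma mem_animals N m v e0 p V : (0 < m)%N -> e0 \in EB N -> path adj e0 p ->
  size p = m.-1.*2 -> subseq V (e0 :: p) -> uniq V -> size V = v ->
  V \in animals N m v.
Proof.
move=> m0 e0N pp sp /subseqP[b sb ->] Vu Vv; rewrite mem_filter Vu Vv eqxx /=.
have sb' : size b == m.*2.-1 by rewrite sb /= sp; case: (m) m0 => //= n _; rewrite doubleS.
apply/allpairsP; exists (e0 :: p, Tuple sb') => /=; split=> //.
  apply/flattenP; exists [seq e0 :: p | p <- paths m.-1.*2 e0].
    by apply/mapP; exists e0.
  by apply/mapP; exists p => //; rewrite -sp; apply: mem_paths.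
by rewrite mem_enum.
Qed.

Definition has_closed (Cl : edge d -> bool) (Vs : seq (seq (edge d))) :=
  has (all Cl) Vs.

Lemma all_closed_animal N S m v (Cl : edge d -> bool) : (0 < m)%N -> (v <= m)%N ->
  inside N S -> starconn S -> (m <= nbd N S)%N ->
  (forall e, bd S e -> Cl e) -> has_closed Cl (animals N m v).
Proof.
move=> m0 vm SN Sc mS SCl.
have : has (bd S) (EB N) by rewrite has_count; apply: leq_trans mS.
move=> /hasP[e0 e0N Se0].
have nS : (m.-1 < nbd N S)%N by rewrite prednK.
have [p [U [pp sp /allP bp [Uu Up nU]]]] := grow SN Sc Se0 nS.
have szu : (v <= size (undup (e0 :: p)))%N.
  rewrite prednK // in nU; apply: leq_trans vm _; apply: leq_trans nU _.
  by apply: uniq_leq_size => // e /Up; rewrite mem_undup.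
apply/hasP; exists (take v (undup (e0 :: p))).
  apply: (@mem_animals _ _ _ e0 p) => //; last by rewrite size_takel.
    by apply: subseq_trans (take_subseq _ _) (undup_subseq _).
  by rewrite take_uniq // undup_uniq.
by apply/allP => e /mem_take; rewrite mem_undup => /bp/SCl.
Qed.

(** Here the walk is long enough to cover the whole boundary, so it meets all the closed edges,
    which by assumption are at least half. *)
Lemma half_closed_animal N S (Cl : edge d -> bool) :
  inside N S -> starconn S -> (0 < nbd N S)%N ->
  ((nbd N S).+1 <= (count (fun e => bd S e && Cl e) (EB N)).*2 + 1)%N ->
  has_closed Cl (animals N (nbd N S) (uphalf (nbd N S))).
Proof.
move=> SN Sc m0; set m := nbd N S; set c := count _ _ => mc.
have : has (bd S) (EB N) by rewrite has_count.
move=> /hasP[e0 e0N Se0].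
have nS : (m.-1 < nbd N S)%N by rewrite prednK.
have [p [U [pp sp /allP bp [Uu Up nU]]]] := grow SN Sc Se0 nS.
have pall e : bd S e -> e \in e0 :: p.
  have Usub : {subset U <= [seq e <- EB N | bd S e]} by move=> a /Up/bp; rewrite mem_bdEB.
  have [|_ UE] := uniq_min_size Uu Usub; last by move=> Se; apply: Up; rewrite UE mem_bdEB.
  by rewrite size_filter -/(nbd N S) -/m; move: nU; rewrite prednK.
pose V := undup [seq e <- e0 :: p | bd S e && Cl e].
have cV : (c <= size V)%N.
  rewrite /c -size_filter; apply: uniq_leq_size; first by rewrite filter_uniq ?EB_uniq.
  move=> e; rewrite mem_undup !mem_filter => /andP[/andP[Se Ce] _].
  by rewrite Se Ce /= pall.
have hV : (uphalf m <= size V)%N.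
  apply: leq_trans cV; rewrite leq_uphalf_double; lia.
apply/hasP; exists (take (uphalf m) V).
  apply: (@mem_animals _ _ _ e0 p) => //; last by rewrite size_takel.
    apply: subseq_trans (take_subseq _ _) _.
    by apply: subseq_trans (undup_subseq _) (filter_subseq _ _).
  by rewrite take_uniq // undup_uniq.
by apply/allP => e /mem_take; rewrite mem_undup mem_filter => /andP[/andP[]].
Qed.

Lemma star_component N S x : (1 < d)%N -> inside N S -> S x ->
  exists T, [/\ inside N T, starconn T, T x & forall e, bd T e -> bd S e].
Proof.
move=> d2 SN; move: S SN x.
apply: (@starconn_ind N (fun S => forall x, S x -> exists T,
  [/\ inside N T, starconn T, T x & forall e, bd T e -> bd S e]) d2) => [S SN Sc x Sx|].
  by exists S.
move=> S T1 T2 T1N T2N ST bST _ IH1 IH2 x; rewrite ST.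
case h1: (T1 x) => /=.
  have [T [TN Tc Tx TT]] := IH1 _ h1; exists T; split=> // e /TT h.
  by rewrite bST h.
move=> /IH2[T [TN Tc Tx TT]]; exists T; split=> // e /TT h.
by rewrite bST h orbT.
Qed.

Definition near (r : nat) x y : bool := [forall j, `|x j - y j| <= r%:Z].

Lemma near_le r s x y : (r <= s)%N -> near r x y -> near s x y.
Proof. by move=> rs /forallP h; apply/forallP => j; have := h j; lia. Qed.

Lemma near_trans r s x y z : near r x y -> near s y z -> near (r + s) x z.
Proof.
by move=> /forallP h1 /forallP h2; apply/forallP => j; have := h1 j; have := h2 j; lia.
Qed.

Lemma near_refl r x : near r x x.
Proof. by apply/forallP => j; rewrite subrr normr0. Qed.

Lemma count_near N r y : (count (fun x => near r x y) (box d N) <= r.*2.+1 ^ d)%N.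
Proof.
pose F x : vtx d := [ffun j => x j - y j].
rewrite -size_box -size_filter -(size_map F); apply: uniq_leq_size.
  rewrite map_inj_uniq ?filter_uniq ?box_uniq // => a b /ffunP ab.
  by apply/ffunP => j; have := ab j; rewrite !ffunE => /addIr.
move=> z /mapP[x]; rewrite mem_filter => /andP[/forallP h _] ->.
by rewrite mem_box; apply/in_boxP => j; rewrite ffunE; have := h j; lia.
Qed.

Definition star x : seq (edge d) :=
  [seq (x, i) | i <- enum 'I_d] ++ [seq (stp x i (- 1), i) | i <- enum 'I_d].

Lemma size_star x : size (star x) = (2 * d)%N.
Proof. by rewrite size_cat (size_map (fun i => (x, i))) (size_map (fun i => (stp x i (-1), i)))
  size_enum_ord; lia. Qed.

Lemma star_uniq x : uniq (star x).
Proof.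
rewrite cat_uniq (map_inj_uniq (f := fun i => (x, i))) ?enum_uniq; last by move=> i j [].
rewrite (map_inj_uniq (f := fun i => (stp x i (-1), i))) ?enum_uniq ?andbT /=; last by move=> i j [].
apply/hasPn => e /mapP[i _ ->]; apply/negP => /mapP[j _ []].
by move=> /(congr1 (fun u : vtx d => u i)) /=; rewrite stpE eqxx; lia.
Qed.

Lemma mem_star x e : e \in star x -> e.1 = x \/ stp e.1 e.2 1 = x.
Proof.
rewrite mem_cat => /orP[/mapP[i _ ->]|/mapP[i _ ->]]; first by left.
by right; rewrite /= stpD addNr stp0.
Qed.

End Lattice.

(** * Open paths *)

Section Environment.
Variables (R : realType) (d : nat) (w : edge d -> R).
Implicit Types (x y : vtx d) (e : edge d) (N : nat) (a b : R) (S : vtx d -> bool).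

Definition ostep a x y : bool :=
  [exists i, (y == stp x i 1) && (a < w (x, i)) || (x == stp y i 1) && (a < w (y, i))].

Lemma ostepP a x y : ostep a x y -> exists2 e, a < w e &
  e.1 = x /\ stp e.1 e.2 1 = y \/ e.1 = y /\ stp e.1 e.2 1 = x.
Proof.
move=> /existsP[i /orP[/andP[/eqP-> h]|/andP[/eqP-> h]]].
  by exists (x, i) => //; left.
by exists (y, i) => //; right.
Qed.

Lemma ostep_edge a e : a < w e -> ostep a e.1 (stp e.1 e.2 1).
Proof.
by case: e => x i /= h; apply/existsP; exists i; rewrite eqxx h.
Qed.

Lemma ostep_sym a x y : ostep a x y = ostep a y x.
Proof. by apply: eq_existsb => i; rewrite orbC. Qed.

Lemma ostep_le a b x y : b <= a -> ostep a x y -> ostep b x y.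
Proof.
move=> ba /existsP[i h]; apply/existsP; exists i.
by case/orP: h => /andP[-> /(le_lt_trans ba)->]; rewrite ?orbT.
Qed.

Lemma path_ostep_le a b x p : b <= a -> path (ostep a) x p -> path (ostep b) x p.
Proof. by move=> ba; apply: sub_path => u v; apply: ostep_le. Qed.

Lemma ostep_near a x y : ostep a x y -> near 1 x y.
Proof.
move=> /ostepP[[u i] _ /= h]; apply/forallP => j.
by case: h => -[<- <-]; rewrite stpE; case: (i == j); lia.
Qed.

Lemma path_near a x p y : path (ostep a) x p -> y \in x :: p -> near (size p) x y.
Proof.
elim: p x => [|z p IH] x /=; first by rewrite inE => _ /eqP->; apply: near_refl.
move=> /andP[/ostep_near xz /IH h]; rewrite inE => /orP[/eqP->|/h zy].
  exact: near_refl.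
by rewrite -add1n; apply: near_trans xz zy.
Qed.

Definition escapes N a x :=
  exists2 p, path (ostep a) x p & ~~ in_box N (last x p).

Definition trapped N a x : bool := in_box N x && ~~ `[<escapes N a x>].

Lemma trapped_inside N a : inside N (trapped N a).
Proof. by move=> x /andP[]. Qed.

Lemma escapes_step N a x y : ostep a x y -> ~~ trapped N a y -> escapes N a x.
Proof.
move=> xy; rewrite negb_and negbK => /orP[yN|/asboolP[p pp pN]].
  by exists [:: y] => //=; rewrite xy.
by exists (y :: p) => //=; rewrite xy.
Qed.

Lemma trapped_step N a x y : ostep a x y -> trapped N a x -> trapped N a y.
Proof.
move=> xy /andP[_ /asboolP h]; apply: contrapT => /negP h'.
by apply: h; apply: escapes_step h'.
Qed.

(** An open edge has both ends trapped or neither, so it cannot cross the boundary. *)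
Lemma bd_trapped N a e : bd (trapped N a) e -> w e <= a.
Proof.
move=> h; rewrite leNgt; apply/negP => /ostep_edge ae; move: h; rewrite /bd.
have h1 := @trapped_step N a _ _ ae; rewrite ostep_sym in ae.
have h2 := @trapped_step N a _ _ ae.
case E1: (trapped N a e.1) => /=; first by rewrite h1.
by move=> /h2; rewrite E1.
Qed.

Lemma cross a S x p : path (ostep a) x p -> S x -> ~~ S (last x p) ->
  exists e, [/\ bd S e, a < w e & e.1 \in x :: p].
Proof.
elim: p x => [|y p IH] x /=; first by move=> _ ->.
move=> /andP[xy yp] Sx Sl; have [Sy|Sy] := boolP (S y).
  by have [e [h1 h2 h3]] := IH y yp Sy Sl; exists e; rewrite inE h3 orbT.
have [e ae [[e1 e2]|[e1 e2]]] := ostepP xy; exists e; split=> //.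
- by rewrite /bd e1 in e2 *; rewrite e2 Sx (negbTE Sy).
- by rewrite e1 mem_head.
- by rewrite /bd e2 e1 Sx (negbTE Sy).
- by rewrite e1 !inE eqxx orbT.
Qed.

Lemma first_exit S x p : S x -> ~~ S (last x p) ->
  exists p1 y p2, [/\ p = p1 ++ y :: p2, all S (x :: p1) & ~~ S y].
Proof.
elim: p x => [|y p IH] x /= Sx; first by rewrite Sx.
move=> Sl; have [Sy|Sy] := boolP (S y); last by exists [::], y, p; rewrite /= Sx.
have [p1 [z [p2 [-> h1 h2]]]] := IH y Sy Sl.
by exists (y :: p1), z, p2; rewrite /= Sx; split.
Qed.

(** Follow a self-avoiding escape path up to its first exit from [S]: distinct vertices bound its
    length by the volume, and the exit edge lies on the boundary of the trapped set, so one of its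
    ends is not trapped. *)
Lemma exit_path N a b S x : inside N S -> S x -> escapes N b x ->
  (forall e, bd S e -> bd (trapped N a) e) ->
  exists p, [/\ path (ostep b) x p, (size p <= count S (box d N))%N &
    ~~ trapped N a (last x p)].
Proof.
move=> SN Sx [p0 pp0] + Sa; case: (shortenP pp0) => p pp pu _ pN {p0 pp0}.
have Sl : ~~ S (last x p) by apply: contra pN; apply: SN.
have [p1 [y [p2 [pE p1S yS]]]] := first_exit Sx Sl.
move: pp pu; rewrite pE -cat_cons cat_path cat_uniq /= => /and3P[pp1 ly _].
move=> /andP[] /andP[xp1 up1] _.
have sz : (size p1 < count S (box d N))%N.
  rewrite -(size_filter S) -[(size p1).+1]/(size (x :: p1)); apply: uniq_leq_size => /=.
    by rewrite xp1.
  by move=> z zp; have Sz := allP p1S z zp; rewrite mem_filter Sz mem_box SN.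
have [h|h] := boolP (trapped N a (last x p1)); last by exists p1; split=> //; apply: ltnW.
exists (rcons p1 y); rewrite rcons_path pp1 ly size_rcons last_rcons; split=> //.
have Sl1 : S (last x p1) by apply: (allP p1S); rewrite mem_last.
have [e _ [[e1 e2]|[e1 e2]]] := ostepP ly.
  have : bd S e by rewrite /bd e2 e1 Sl1 (negbTE yS).
  by move=> /Sa; rewrite /bd e2 e1 h.
have : bd S e by rewrite /bd e2 e1 Sl1 (negbTE yS).
by move=> /Sa; rewrite /bd e2 e1 h; case: (trapped _ _ y).
Qed.

(** The component of the trapped set around [x] has an [a]-closed boundary, hence fewer than [m]
    boundary edges, hence volume at most [m^d]. *)
Lemma escape_short N a b m v x : (1 < d)%N -> (0 < m)%N -> (v <= m)%N ->
  ~~ has_closed (fun e => w e <= a) (animals d N m v) ->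
  in_box N x -> escapes N b x ->
  exists p, [/\ path (ostep b) x p, (size p <= m ^ d)%N &
    ~~ trapped N a (last x p)].
Proof.
move=> d2 m0 vm nC xN xb; have [xt|xt] := boolP (trapped N a x); last by exists [::].
have [T [TN Tc Tx Ta]] := star_component d2 (@trapped_inside N a) xt.
have [p [p1 p2 p3]] := exit_path TN Tx xb Ta; exists p; split=> //.
apply: leq_trans p2 _; apply: leq_trans (volume_le_pow d2 TN) _.
rewrite leq_exp2r; last by apply: ltnW.
rewrite ltnNge; apply/negP => mT; case/negP: nC.
by apply: all_closed_animal Tc mT _ => // e /Ta/bd_trapped.
Qed.

Lemma all_escape N a x : (1 < d)%N -> in_box N x ->
  ~~ has_closed (fun e => w e <= a) (animals d N (2 * d) (2 * d)) ->
  escapes N a x.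
Proof.
move=> d2 xN nA; apply: contrapT => xa.
have xt : trapped N a x by rewrite /trapped xN; apply/asboolP.
have [T [TN Tc Tx Ta]] := star_component d2 (@trapped_inside N a) xt.
case/negP: nA; apply: all_closed_animal Tc _ _ => //.
- by lia.
- exact: bd_ge_star Tx.
- by move=> e /Ta/bd_trapped.
Qed.

(** * Weighted isoperimetry and the Cheeger argument *)

Section Poincare.
Hypothesis w0 : forall e, 0 < w e.
Implicit Types f : vtx d -> R.

Definition grad (f : vtx d -> R) e : R := f e.1 - f (stp e.1 e.2 1).

Definition denergy N (f : vtx d -> R) : R :=
  \sum_(e <- EB d N) w e * grad f e ^+ 2.

Definition nenergy N (f : vtx d -> R) r x : R :=
  \sum_(e <- EB d N | near r x e.1) w e * grad f e ^+ 2.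

Lemma wgrad_ge0 f e : 0 <= w e * grad f e ^+ 2.
Proof. by rewrite mulr_ge0 ?sqr_ge0 // ltW. Qed.

Lemma nenergy_ge0 N f r x : 0 <= nenergy N f r x.
Proof. by apply: sumr_ge0 => e _; apply: wgrad_ge0. Qed.

Lemma chain_sq f (B : R) x p : 0 <= B ->
  path (fun u v => (f u - f v) ^+ 2 <= B) x p ->
  (f x - f (last x p)) ^+ 2 <= (size p)%:R ^+ 2 * B.
Proof.
move=> B0 h; rewrite -[in leRHS](sqr_sqrtr B0) -exprMn.
rewrite -[leLHS]real_normK ?num_real // lerXn2r ?nnegrE ?mulr_ge0 ?sqrtr_ge0 //.
elim: p x h => [|y p IH] x /=; first by rewrite subrr normr0 mul0r.
move=> /andP[xy /IH h].
have s1 : `|f x - f y| <= Num.sqrt B by rewrite -sqrtr_sqr ler_wsqrtr.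
have := ler_normD (f x - f y) (f y - f (last y p)); rewrite addrA subrK.
by rewrite -natr1 mulrDl mul1r; lra.
Qed.

Lemma path_energy N f a r x y p : 0 < a -> (forall z, ~~ in_box N z -> f z = 0) ->
  path (ostep a) y p -> near r x y ->
  (f y - f (last y p)) ^+ 2 <=
    (size p)%:R ^+ 2 * (nenergy N f (r + size p) x / a).
Proof.
move=> a0 fN pp xy; apply: chain_sq.
  by rewrite divr_ge0 ?nenergy_ge0 // ltW.
have pn : all (near (r + size p) x) (y :: p).
  by apply/allP => z /(path_near pp) yz; apply: near_trans xy yz.
apply: (sub_in_path _ pn pp) => u v un vn /ostepP[e ae he].
have en : near (r + size p) x e.1 by case: he => -[-> _].
have -> : (f u - f v) ^+ 2 = grad f e ^+ 2.
  by rewrite /grad; case: he => -[<- <-] //; rewrite -sqrrN opprB.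
(* Off [EB] both ends of the edge lie outside the box, where [f] vanishes. *)
have [eN|eN] := boolP (e \in EB d N); last first.
  have /negP eB := eN; rewrite mem_EB in eB.
  rewrite /grad !fN ?subrr ?expr0n ?divr_ge0 ?nenergy_ge0 ?(ltW a0) //;
    apply/negP => h; apply: eB; apply: (@in_box_stp d N e.1 e.2); by [left|right].
rewrite ler_pdivlMr // mulrC.
apply: le_trans (_ : w e * grad f e ^+ 2 <= _); first by rewrite ler_wpM2r ?sqr_ge0 // ltW.
rewrite /nenergy big_mkcond /= (bigD1_seq e) ?EB_uniq //= en.
by rewrite lerDl sumr_ge0 // => e' _; case: ifP => // _; apply: wgrad_ge0.
Qed.

Lemma sum_nenergy N f r :
  \sum_(x <- box d N) nenergy N f r x <= (r.*2.+1 ^ d)%:R * denergy N f.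
Proof.
rewrite /nenergy (exchange_big_dep xpredT) //= /denergy mulr_sumr ler_sum // => e _.
rewrite -big_filter big_const_seq count_predT iter_addr_0 -[leLHS]mulr_natl.
rewrite ler_wpM2r ?wgrad_ge0 // ler_nat size_filter.
exact: count_near.
Qed.

Definition nopen N a S := count (fun e => bd S e && (a < w e)) (EB d N).

(* [z x] is the point of the open cluster to which [x] is attached. Moving mass
   from [x] to [z x] perturbs the volume of a set only near its boundary. *)
Lemma weighted_isoperimetry N m L a (z : vtx d -> vtx d) :
  (1 < d)%N -> (0 < N)%N ->
  (forall x, in_box N x -> exists p, [/\ path (ostep 0) x p, last x p = z x &
     (size p <= L)%N]) ->
  (forall k, (m <= k <= size (EB d N))%N -> ~~ has_closed (fun e => w e <= a) (animals d N k (uphalf k))) ->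
  (0 < m)%N -> (m ^ d + L.*2.+1 ^ d * m <= N)%N ->
  forall S, inside N S ->
  (count (fun x => S (z x) && `[<escapes N a (z x)>]) (box d N) <= 8 * N * nopen N a S)%N.
Proof.
move=> d2 N0 zP nA m0 mN; apply: (starconn_ind d2) => [S SN Sc|]; last first.
  move=> S T1 T2 T1N T2N ST bST b12 IH1 IH2.
  have -> : nopen N a S = (nopen N a T1 + nopen N a T2)%N.
    rewrite /nopen -count_predUI [X in (_ + X)%N](@eq_count _ _ pred0) ?count_pred0 ?addn0.
      by apply: eq_count => e /=; rewrite bST; case: (bd T1 e); case: (bd T2 e); case: (_ < _).
    by move=> e /=; have := b12 e; case: (bd T1 e); case: (bd T2 e); case: (_ < _).
  rewrite mulnDr; apply: leq_trans (leq_add IH1 IH2).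
  rewrite -count_predUI; apply: leq_trans (leq_addr _ _); apply: sub_count => x /=.
  by rewrite ST; case: (T1 _); case: (T2 _); case: `[<_>].
have [/hasP[x0 x0N /andP[Sx0 /asboolP ex0]]|] :=
  boolP (has (fun x => S (z x) && `[<escapes N a (z x)>]) (box d N)); last first.
  by rewrite has_count -leqNgt leqn0 => /eqP->.
(* A path escaping from a point of [S] crosses an open boundary edge; this settles short boundaries
   below. *)
have open1 : (0 < nopen N a S)%N.
  have [p pp pN] := ex0.
  have Sl : ~~ S (last (z x0) p) by apply: contra pN; apply: SN.
  have [e [Se ae _]] := cross pp Sx0 Sl.
  by rewrite -has_count; apply/hasP; exists e; rewrite ?Se ?(bd_EB SN).
(* If [z x] is in [S] but [x] is not, the path between them crosses the boundary within distance [L]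
   of [x]; each boundary edge is charged by at most [(2L+1)^d] such [x]. *)
have vol : (count (fun x => S (z x) && `[<escapes N a (z x)>]) (box d N) <=
    count S (box d N) + L.*2.+1 ^ d * nbd N S)%N.
  apply: leq_trans (_ : count S (box d N) + \sum_(e <- [seq e <- EB d N | bd S e])
     count (fun x => near L x e.1) (box d N) <= _)%N; last first.
    rewrite leq_add2l /nbd -size_filter mulnC -sum1_size big_distrl /=.
    by apply: leq_sum => e _; rewrite mul1n count_near.
  apply: leq_trans (_ : count S (box d N) + count (fun x => ~~ S x && S (z x)) (box d N) <= _)%N.
    rewrite -count_predUI; apply: leq_trans (leq_addr _ _); apply: sub_count => x /=.
    by case: (S x); case: (S (z x)).
  rewrite leq_add2l; apply: count_le_sum => x; rewrite mem_box => xN /andP[Sx Szx].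
  have [p [pp pz pL]] := zP x xN; rewrite -pz in Szx.
  have [|e [Se _ ep]] := @cross 0 (fun y => ~~ S y) x p pp Sx; first by rewrite negbK.
  have Se' : bd S e by move: Se; rewrite /bd; case: (S _); case: (S _).
  exists e; first by rewrite mem_bdEB.
  exact: near_le pL (path_near pp ep).
apply: leq_trans vol _.
have cnt : nbd N S = (nopen N a S + count (fun e => bd S e && (w e <= a)%R) (EB d N))%N.
  rewrite /nopen -count_predUI [X in (_ + X)%N](@eq_count _ _ pred0) ?count_pred0 ?addn0.
    by apply: eq_count => e /=; rewrite leNgt; case: (bd S e); case: (_ < _).
  by move=> e /=; rewrite leNgt; case: (bd S e); case: (_ < _).
(* Long boundary: at least half of it is open, the count is at most [3N+1] times its size, and
   [2(3N+1) <= 8N]. Short boundary: the count is at most [N], and one open edge suffices. *)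
have [mS|mS] := leqP m (nbd N S).
  have half : (nbd N S <= 2 * nopen N a S)%N.
    rewrite leqNgt; apply/negP => h; have hm : (m <= nbd N S <= size (EB d N))%N by rewrite mS count_size.
    have /negP := nA _ hm; apply.
    apply: half_closed_animal => //; first exact: leq_trans mS.
    lia.
  have h1 := volume_le_width (ltnW d2) SN.
  have h2 : (L.*2.+1 ^ d * nbd N S <= N * nbd N S)%N.
    rewrite leq_mul2r; apply/orP; right; apply: leq_trans mN.
    by apply: leq_trans (leq_addl _ _); rewrite leq_pmulr.
  nia.
have h1 := volume_le_pow d2 SN.
have h2 : ((nbd N S).+1 ^ d <= m ^ d)%N by rewrite leq_exp2r // ltnW.
have h3 : (L.*2.+1 ^ d * nbd N S <= L.*2.+1 ^ d * m)%N by rewrite leq_mul2l ltnW ?orbT.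
nia.
Qed.

(** Discrete coarea formula, by induction on the size of the support [S] of [h]. Subtracting the
    least nonzero value [m] from [h] on [S] splits [|grad h|] exactly into [|grad h'|] plus [m]
    times the indicator of the boundary of [S]. *)
Lemma coarea N a (k : nat) (G : vtx d -> Prop) (z : vtx d -> vtx d) :
  (forall S, inside N S -> (forall x, S x -> G x) ->
     (count (fun x => S (z x)) (box d N) <= k * nopen N a S)%N) ->
  forall h : vtx d -> R, (forall x, 0 <= h x) ->
  (forall x, h x != 0 -> in_box N x /\ G x) ->
  \sum_(x <- box d N) h (z x) <= k%:R * \sum_(e <- EB d N | a < w e) `|grad h e|.
Proof.
move=> iso h; move: {2}(count _ _) (leqnn (count (fun x => h x != 0) (box d N))) => n.
elim: n h => [|n IH] h hn h0 hG.
  have hz x : h x = 0.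
    apply/eqP; apply/negPn/negP => hx; have [xN _] := hG x hx.
    move: hn; rewrite leqn0 => /eqP/eqP; rewrite -[_ == _]negbK -lt0n -has_count.
    by move=> /hasPn/(_ x); rewrite mem_box xN hx => /(_ isT).
  by rewrite big1 // mulr_ge0 // sumr_ge0.
have [/hasP[x1 x1N hx1]|] := boolP (has (fun x => h x != 0) (box d N)); last first.
  by move=> nh; apply: IH => //; move: nh; rewrite has_count -leqNgt leqn0 => /eqP->.
have [|x0 + x0min] := @seq_argmin _ _ h [seq x <- box d N | h x != 0] x1.
  by rewrite mem_filter hx1.
rewrite mem_filter => /andP[hx0 x0N]; set m := h x0.
pose S x := h x != 0; pose h' x := if S x then h x - m else 0.
have hm x : S x -> m <= h x.
  by move=> Sx; apply: x0min; rewrite mem_filter [h x != 0]Sx mem_box (hG _ Sx).1.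
have hE x : h x = h' x + m * (S x)%:R.
  rewrite /h'; case: ifPn => Sx; first by rewrite mulr1 subrK.
  by rewrite mulr0 addr0; apply/eqP; move: Sx; rewrite negbK.
have IH' : \sum_(x <- box d N) h' (z x) <= k%:R * \sum_(e <- EB d N | a < w e) `|grad h' e|.
  apply: IH.
  - have : (count (fun x => h' x != 0%R) (box d N) < count S (box d N))%N.
      rewrite -!size_filter; apply: (@leq_trans (size (x0 :: [seq x <- box d N | h' x != 0%R]))) => //.
      apply: uniq_leq_size.
        rewrite /= filter_uniq ?box_uniq // andbT mem_filter negb_and negbK.
        by rewrite /h' /S [h x0 != 0]hx0 subrr eqxx.
      move=> x; rewrite inE !mem_filter => /orP[/eqP->|/andP[h1 ->]].
        by rewrite /S hx0.
      by rewrite andbT; move: h1; rewrite /h'; case: ifPn; rewrite ?eqxx.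
    by move=> lt; rewrite -ltnS; apply: leq_trans lt _.
  - by move=> x; rewrite /h'; case: ifPn => // Sx; rewrite subr_ge0 hm.
  - by move=> x; rewrite /h'; case: ifPn; rewrite ?eqxx // => Sx _; apply: hG.
have m0 : 0 <= m by apply: h0.
rewrite (eq_bigr (fun x => h' (z x) + m * (S (z x))%:R)) // big_split /=.
have -> : \sum_(x <- box d N) m * (S (z x))%:R = m * (count (fun x => S (z x)) (box d N))%:R.
  rewrite -mulr_sumr -sum1_count natr_sum [X in _ = _ * X]big_mkcond /=.
  by congr (_ * _); apply: eq_bigr => x _; case: (S _).
have gE e : `|grad h e| = `|grad h' e| + m * (bd S e)%:R.
  rewrite /grad /bd (hE e.1) (hE (stp _ _ _)) /h'.
  case: ifPn => S1; case: ifPn => S2 /=; rewrite ?mulr1 ?mulr0 ?addr0 ?sub0r ?subr0 //.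
  - by rewrite !subrK opprB addrA subrK.
  - by rewrite subrK !ger0_norm ?subrK // subr_ge0 hm.
  - by rewrite subrK !normrN !ger0_norm ?subrK // subr_ge0 hm.
rewrite (eq_bigr (fun e => `|grad h' e| + m * (bd S e)%:R)) // big_split /= mulrDr lerD //.
have -> : \sum_(e <- EB d N | a < w e) m * (bd S e)%:R = m * (nopen N a S)%:R.
  rewrite -mulr_sumr /nopen -sum1_count natr_sum [X in _ = _ * X]big_mkcond /=.
  rewrite [X in _ * X]big_mkcond /=.
  by congr (_ * _); apply: eq_bigr => e _; case: (bd S e); case: (_ < _).
rewrite mulrCA ler_wpM2l // -natrM ler_nat; apply: iso.
- by move=> x /hG[].
- by move=> x /hG[].
Qed.

(* Apply [coarea] to [f ^ 2] killed on the trapped vertices; open edges never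
   join a trapped vertex to an untrapped one. *)
Lemma cheeger N a (k : nat) (z : vtx d -> vtx d) f :
  0 < a -> (0 < k)%N -> (0 < d)%N ->
  (forall x, ~~ in_box N x -> f x = 0) ->
  (forall x, in_box N x -> ~~ trapped N a (z x)) ->
  (forall x, in_box N x -> escapes N a x -> z x = x) ->
  (forall S, inside N S -> (forall x, S x -> escapes N a x) ->
     (count (fun x => S (z x)) (box d N) <= k * nopen N a S)%N) ->
  \sum_(x <- box d N) f (z x) ^+ 2 <= (4 * d * k ^ 2)%:R / a * denergy N f.
Proof.
move=> a0 k0 d0 fN zG zid iso.
pose h x : R := if trapped N a x then 0 else f x ^+ 2.
have h0 x : 0 <= h x by rewrite /h; case: ifP; rewrite ?sqr_ge0.
have hz : {in box d N, forall x, f (z x) ^+ 2 = h (z x)}.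
  by move=> x; rewrite mem_box => /zG; rewrite /h => /negbTE->.
rewrite (eq_big_seq _ hz); set Q := \sum_(x <- _) _.
have hG x : h x != 0 -> in_box N x /\ escapes N a x.
  rewrite /h; case: ifPn; rewrite ?eqxx // negb_and negbK => /orP[xN|/asboolP //].
    by rewrite fN ?expr0n ?eqxx.
  move=> xa hx; split=> //; apply: contrapT => /negP xN.
  by move: hx; rewrite fN ?expr0n ?eqxx.
have := @coarea N a k _ z iso h h0 hG; rewrite -/Q => Qle.
(* The weight in [|u^2 - v^2| <= A (u-v)^2 + (u^2+v^2)/(2A)], chosen so that the last term
   contributes [Q/2], which the left side absorbs. *)
pose A : R := (2 * d * k)%:R.
have A0 : 0 < A by rewrite ltr0n !muln_gt0 d0 k0.
have AE : A = (2 * d * k)%:R by []; clearbody A.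
have ge e : a < w e -> `|grad h e| <= A * grad f e ^+ 2 + (h e.1 + h (stp e.1 e.2 1)) / (2 * A).
  move=> /ostep_edge ae; rewrite /grad /h; set y := stp _ _ _ in ae *.
  have -> : trapped N a y = trapped N a e.1.
    by apply/idP/idP; apply: trapped_step; rewrite // ostep_sym.
  case: ifP => _; first by rewrite subrr normr0 addr0 mul0r addr0 mulr_ge0 ?sqr_ge0 // ltW.
  set u := f e.1; set v := f y.
  have s1 := sqr_ge0 (2 * A * (u - v) - (u + v)).
  have s2 := sqr_ge0 (2 * A * (u - v) + (u + v)).
  have s3 := sqr_ge0 (u - v).
  have -> : A * (u - v) ^+ 2 + (u ^+ 2 + v ^+ 2) / (2 * A) =
     (2 * A ^+ 2 * (u - v) ^+ 2 + (u ^+ 2 + v ^+ 2)) / (2 * A).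
    by clear -A0; field; rewrite gt_eqF.
  rewrite ler_pdivlMr; last by rewrite mulr_gt0.
  rewrite -[X in _ * X]gtr0_norm; last by rewrite mulr_gt0.
  rewrite -normrM ler_norml; apply/andP; split; nra.
have sumh : \sum_(e <- EB d N | a < w e) (h e.1 + h (stp e.1 e.2 1)) <= (2 * d)%:R * Q.
  (* Trapped vertices carry no [h], and the other vertices of the box are fixed by [z]. *)
  have hQ : \sum_(x <- box d N) h x <= Q.
    rewrite /Q !big_seq; apply: ler_sum => x; rewrite mem_box => xN.
    have [xt|xt] := boolP (trapped N a x); first by rewrite {1}/h xt.
    by rewrite zid //; move: xt; rewrite /trapped xN /= negbK => /asboolP.
  have hsum (F : vtx d -> vtx d) (M : nat) : injective F ->
      \sum_(x <- box d M) h (F x) <= \sum_(x <- box d N) h x.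
    move=> Finj; rewrite -(big_map F xpredT h) (bigID (fun x => in_box N x)) /=.
    rewrite [X in _ + X]big1 ?addr0; last first.
      by move=> x xN; apply/eqP; apply/negPn/negP => /hG[]; rewrite (negbTE xN).
    rewrite -big_filter; apply: ler_sum_sub => //.
    - by rewrite filter_uniq // map_inj_uniq // box_uniq.
    - exact: box_uniq.
    - by move=> x; rewrite mem_filter mem_box => /andP[].
  apply: le_trans (_ : \sum_(e <- EB d N) (h e.1 + h (stp e.1 e.2 1)) <= _).
    by rewrite [leLHS]big_mkcond; apply: ler_sum => e _; case: ifP; rewrite ?addr_ge0.
  rewrite /EB big_allpairs exchange_big /= natrM mulrAC mulrC -[d in d%:R]card_ord.
  rewrite -sum1_card natr_sum mulr_suml -big_enum /=; apply: ler_sum => i _.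
  rewrite big_split /= mul1r mulr_natl mulr2n.
  have i1 : injective (fun x : vtx d => stp x i 1).
    move=> x y /(congr1 (fun u => stp u i (-1))).
    by rewrite !stpD subrr !stp0.
  by rewrite lerD // (le_trans _ hQ) // ?(hsum id) // (hsum (fun x => stp x i 1)).
apply: le_trans (_ : 2 * k%:R * A * \sum_(e <- EB d N | a < w e) grad f e ^+ 2 <= _); last first.
  have -> : (4 * d * k ^ 2)%:R / a * denergy N f = 2 * k%:R * A * (denergy N f / a).
    rewrite AE !natrM; field; rewrite gt_eqF //.
  rewrite ler_wpM2l ?mulr_ge0 ?(ltW A0) // ler_pdivlMr // mulr_suml /denergy.
  rewrite [leLHS]big_mkcond; apply: ler_sum => e _; case: ifP => [ae|_]; last exact: wgrad_ge0.
  by rewrite mulrC ler_wpM2r ?sqr_ge0 // ltW.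
have le1 : \sum_(e <- EB d N | a < w e) `|grad h e| <=
   A * \sum_(e <- EB d N | a < w e) grad f e ^+ 2 + (2 * d)%:R * Q / (2 * A).
  apply: le_trans (ler_sum _ ge) _; rewrite big_split /= -mulr_sumr -mulr_suml lerD2l.
  by rewrite ler_wpM2r // invr_ge0 mulr_ge0 // ltW.
have := le_trans Qle (ler_wpM2l (ler0n _ k) le1).
have -> : k%:R * (A * \sum_(e <- EB d N | a < w e) grad f e ^+ 2 + (2 * d)%:R * Q / (2 * A)) =
  k%:R * A * \sum_(e <- EB d N | a < w e) grad f e ^+ 2 + Q / 2.
  rewrite AE !natrM; field; rewrite !pnatr_eq0 -!lt0n d0 k0 //.
by move=> h1; lra.
Qed.

Lemma nenergy_le N f r s x : (r <= s)%N -> nenergy N f r x <= nenergy N f s x.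
Proof.
move=> rs; rewrite /nenergy [leLHS]big_mkcond [leRHS]big_mkcond; apply: ler_sum => e _.
case: ifPn => [/(near_le rs)->//|_]; case: ifP => // _; exact: wgrad_ge0.
Qed.

(** Compare [f x] with [f (z x)], which [cheeger] controls, along at most [k^d] [s]-open and then at
    most [m^d] [t]-open steps. Increments are charged to the energy near [x]; summing over [x] costs
    the volume of the neighbourhood. *)
Lemma spectral_gap N (xi t s : R) (m k : nat) f :
  let L := (k ^ d + m ^ d)%N in
  (1 < d)%N -> (0 < N)%N -> (0 < m)%N -> (0 < k)%N ->
  0 < xi -> 0 < t -> 0 < s ->
  (m ^ d + L.*2.+1 ^ d * m <= N)%N ->
  (forall j, (m <= j <= size (EB d N))%N ->
     ~~ has_closed (fun e => w e <= xi) (animals d N j (uphalf j))) ->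
  ~~ has_closed (fun e => w e <= t) (animals d N k k) ->
  ~~ has_closed (fun e => w e <= s) (animals d N (2 * d) (2 * d)) ->
  (forall x, ~~ in_box N x -> f x = 0) ->
  \sum_(x <- box d N) f x ^+ 2 <=
    (2 * (4 * d * (8 * N) ^ 2)%:R / xi
     + 4 * ((k ^ d) ^ 2 * (k ^ d).*2.+1 ^ d)%:R / s
     + 4 * (L ^ 2 * L.*2.+1 ^ d)%:R / t) * denergy N f.
Proof.
move=> L d2 N0 m0 k0 xi0 t0 s0 mN Bxi Bt Bs fN.
(* The hypothesis at level [xi] is also used at [j = m], for the second leg of the path. *)
have mEB : (m <= size (EB d N))%N.
  apply: leq_trans (_ : N <= _)%N.
    apply: leq_trans mN; apply: leq_trans (leq_addr _ _).
    by rewrite -{1}[m]expn1 leq_pexp2l // ltnW.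
  rewrite size_EB; apply: leq_trans (leq_pmulr _ (ltnW d2)).
  by rewrite -{1}[N]expn1; apply: leq_trans (leq_pexp2l _ (ltnW d2)) => //; rewrite expn1; lia.
have Bm : (m <= m <= size (EB d N))%N by rewrite leqnn.
have uh j : (uphalf j <= j)%N by rewrite leq_uphalf_double -addnn leq_addr.
have /choice[z zP] : forall x, exists z, in_box N x ->
    (exists p1 p2, [/\ path (ostep s) x p1, (size p1 <= k ^ d)%N,
      path (ostep t) (last x p1) p2, (size p2 <= m ^ d)%N & z = last (last x p1) p2])
    /\ ~~ trapped N xi z /\ (escapes N xi x -> z = x).
  move=> x; have [xN|] := boolP (in_box N x); last by move=> _; exists x.
  have [xe|xe] := pselect (escapes N xi x).
    exists x => _; split; first by exists [::], [::].
    by split=> //; rewrite /trapped xN /= negbK; apply/asboolP.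
  have xs : escapes N s x by apply: all_escape.
  have [p1 [pp1 sp1 l1]] := escape_short d2 k0 (leqnn k) Bt xN xs.
  have [yN|yN] := boolP (in_box N (last x p1)); last first.
    exists (last x p1) => _; split; first by exists p1, [::].
    by split=> //; rewrite /trapped (negbTE yN).
  have ye : escapes N t (last x p1).
    by move: l1; rewrite /trapped yN /= negbK => /asboolP.
  have [p2 [pp2 sp2 l2]] := escape_short d2 m0 (uh m) (Bxi m Bm) yN ye.
  by exists (last (last x p1) p2) => _; split; first by exists p1, p2.
have zpath x : in_box N x -> exists p, [/\ path (ostep 0) x p, last x p = z x &
     (size p <= L)%N].
  move=> /zP[[p1 [p2 [h1 h2 h3 h4 ->]]] _]; exists (p1 ++ p2).
  rewrite cat_path last_cat size_cat leq_add // (path_ostep_le (ltW s0) h1).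
  by rewrite (path_ostep_le (ltW t0) h3).
have iso S : inside N S -> (forall x, S x -> escapes N xi x) ->
    (count (fun x => S (z x)) (box d N) <= 8 * N * nopen N xi S)%N.
  move=> SN Se; apply: leq_trans (weighted_isoperimetry d2 N0 zpath Bxi m0 mN SN).
  by apply: sub_count => x /= Sz; rewrite Sz; apply/asboolP/Se.
have chg := @cheeger N xi (8 * N) z f xi0 _ (ltnW d2) fN _ _ iso.
have {}chg : \sum_(x <- box d N) f (z x) ^+ 2 <= (4 * d * (8 * N) ^ 2)%:R / xi * denergy N f.
  by apply: chg => [|x /zP[_ []]|x /zP[_ []]//]; rewrite ?muln_gt0.
have pw x : in_box N x -> f x ^+ 2 <= 2 * f (z x) ^+ 2
    + 4 * ((k ^ d) ^ 2)%:R / s * nenergy N f (k ^ d) x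
    + 4 * (L ^ 2)%:R / t * nenergy N f L x.
  move=> /zP[[p1 [p2 [h1 h2 h3 h4 zE]]] _].
  have e1 := path_energy s0 fN h1 (near_refl 0 x).
  have e2 := path_energy t0 fN h3 (path_near h1 (mem_last _ _)).
  rewrite -zE in e2; set y := last x p1 in e1 e2 *.
  have b1 : (f x - f y) ^+ 2 <= ((k ^ d) ^ 2)%:R / s * nenergy N f (k ^ d) x.
    apply: le_trans e1 _; rewrite add0n natrX -[X in _ <= X]mulrA [X in _ <= _ * X]mulrC.
    apply: ler_pM; rewrite ?exprn_ge0 ?divr_ge0 ?nenergy_ge0 ?(ltW s0) //.
      by rewrite lerXn2r ?nnegrE ?ler0n // ler_nat.
    by rewrite ler_wpM2r ?invr_ge0 ?(ltW s0) // nenergy_le.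
  have b2 : (f y - f (z x)) ^+ 2 <= (L ^ 2)%:R / t * nenergy N f L x.
    apply: le_trans e2 _; rewrite [in leRHS]natrX -[X in _ <= X]mulrA [X in _ <= _ * X]mulrC.
    apply: ler_pM; rewrite ?exprn_ge0 ?divr_ge0 ?nenergy_ge0 ?(ltW t0) //.
      rewrite lerXn2r ?nnegrE ?ler0n // ler_nat.
      by apply: leq_trans h4 _; rewrite /L leq_addl.
    by rewrite ler_wpM2r ?invr_ge0 ?(ltW t0) // nenergy_le // leq_add.
  (* These squares give [f(x)^2 <= 2 f(z x)^2 + 2 (f(x) - f(z x))^2] and split the last square into
     the two legs. *)
  have s1 := sqr_ge0 (f x - 2 * f (z x)).
  have s2 := sqr_ge0 ((f x - f y) - (f y - f (z x))).
  rewrite -!mulrA in b1 b2 *.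
  move: b1 b2; set B1 := _%:R * _; set B2 := _%:R * _ => b1 b2; nra.
apply: le_trans (_ : \sum_(x <- box d N) (2 * f (z x) ^+ 2
    + 4 * ((k ^ d) ^ 2)%:R / s * nenergy N f (k ^ d) x
    + 4 * (L ^ 2)%:R / t * nenergy N f L x) <= _).
  by rewrite !big_seq; apply: ler_sum => x; rewrite mem_box => /pw.
rewrite !big_split /= -!mulr_sumr [leRHS]mulrDl [X in _ <= X + _]mulrDl.
apply: lerD; first apply: lerD.
- by rewrite -!mulrA ler_wpM2l // mulrA.
- rewrite natrM -!mulrA ler_wpM2l // ler_wpM2l // [X in _ <= X]mulrCA ler_wpM2l ?invr_ge0 ?(ltW s0) //.
  exact: sum_nenergy.
- rewrite natrM -!mulrA ler_wpM2l // ler_wpM2l // [X in _ <= X]mulrCA ler_wpM2l ?invr_ge0 ?(ltW t0) //.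
  exact: sum_nenergy.
Qed.

End Poincare.

(** * The Dirichlet eigenvalue *)

Section Eigenvalue.
Hypothesis w0 : forall e, 0 < w e.
Implicit Types f : vtx d -> R.

Lemma cond_ge0 x y : 0 <= cond w x y.
Proof. by apply: sumr_ge0 => i _; rewrite addr_ge0 // mulr_ge0 // ltW. Qed.

Lemma condC x y : cond w x y = cond w y x.
Proof. by apply: eq_bigr => i _; rewrite addrC. Qed.

Lemma energy_ge0 n f : 0 <= energy w n f.
Proof.
rewrite /energy mulr_ge0 ?invr_ge0 //.
by do 2![apply: sumr_ge0 => ? _]; rewrite mulr_ge0 ?cond_ge0 ?sqr_ge0.
Qed.

Lemma nbr_stp x i : nbr x (stp x i 1).
Proof.
rewrite /nbr (bigD1 i) //= big1 => [|j ji].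
  by rewrite stpE eqxx; apply/eqP; lia.
by rewrite stpE eq_sym (negbTE ji) mul0r addr0 subrr.
Qed.

Lemma cond_stp x i : w (x, i) <= cond w x (stp x i 1).
Proof.
rewrite /cond (bigD1 i) //= vadd_unitv eqxx mul1r -addrA lerDl addr_ge0 //.
  by rewrite mulr_ge0 // ltW.
by apply: sumr_ge0 => j _; rewrite addr_ge0 // mulr_ge0 // ltW.
Qed.

(** The double sum runs over both orientations of each edge; only the one from [x] to [x + e_i] is
    kept, and the [2] cancels the [1/2]. *)
Lemma denergy_le_energy n N f : (n <= N)%N -> (forall x, ~~ in_box n x -> f x = 0) ->
  denergy N f <= 2 * energy w n f.
Proof.
move=> nN fn; rewrite /energy mulrA divff ?mul1r ?pnatr_eq0 //.
apply: le_trans (_ : \sum_(e <- EB d n) w e * grad f e ^+ 2 <= _).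
  rewrite /denergy (bigID (mem (EB d n))) /= [X in _ + X]big1 ?addr0; last first.
    move=> e eN; rewrite /grad !fn ?subrr ?expr0n ?mulr0 //;
      apply: contra eN => h; rewrite mem_EB; apply: (@in_box_stp d n e.1 e.2); by [left|right].
  rewrite -big_filter; apply: ler_sum_sub.
  - by rewrite filter_uniq ?EB_uniq.
  - exact: EB_uniq.
  - by move=> e; rewrite mem_filter => /andP[].
  - by move=> e; apply: wgrad_ge0.
rewrite /EB big_allpairs /= big_seq [leRHS]big_seq; apply: ler_sum => x; rewrite mem_box => xB.
pose F y := cond w x y * (f x - f y) ^+ 2.
apply: le_trans (_ : \sum_(y <- [seq stp x i 1 | i <- enum 'I_d]) F y <= _).
  rewrite [leRHS]big_map; apply: ler_sum => i _.
  by rewrite /F /grad ler_wpM2r ?sqr_ge0 // cond_stp.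
rewrite -[leRHS]big_filter; apply: ler_sum_sub.
- rewrite map_inj_uniq ?enum_uniq // => i j /(congr1 (fun u : vtx d => u i)) /=.
  by rewrite !stpE eqxx; case: eqP => // _; lia.
- by rewrite filter_uniq ?box_uniq.
- move=> y /mapP[i _ ->]; rewrite mem_filter nbr_stp mem_box /=.
  apply/in_boxP => j; have /in_boxP/(_ j) := xB; rewrite stpE; case: (i == j); lia.
- by move=> y; rewrite mulr_ge0 ?cond_ge0 ?sqr_ge0.
Qed.

Definition dirac_fun x y : R := (y == x)%:R.

Lemma sum_dirac (s : seq (vtx d)) x (F : vtx d -> R) : uniq s -> (forall y, 0 <= F y) ->
  \sum_(y <- s) (y == x)%:R * F y <= F x.
Proof.
move=> su F0; apply: le_trans (_ : \sum_(y <- [seq y <- s | y == x]) F y <= _).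
  rewrite big_filter [leRHS]big_mkcond; apply: ler_sum => y _.
  by case: eqP; rewrite ?mul1r ?mul0r.
apply: le_trans (_ : \sum_(y <- [:: x]) F y <= _); last by rewrite big_seq1.
apply: ler_sum_sub => //; first by rewrite filter_uniq.
by move=> y; rewrite mem_filter inE => /andP[].
Qed.

Lemma dirac_admissible n x : in_box n x ->
  (forall y, ~~ in_box n y -> dirac_fun x y = 0) /\
  \sum_(y <- box d n) dirac_fun x y ^+ 2 = 1.
Proof.
move=> xn; split.
  by move=> y; rewrite /dirac_fun; case: eqP => // ->; rewrite xn.
rewrite (bigD1_seq x) ?mem_box ?box_uniq //= /dirac_fun eqxx expr1n big1 ?addr0 //.
by move=> y /negbTE->; rewrite expr0n.
Qed.

Lemma sum_cond (s : seq (vtx d)) x : uniq s ->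
  \sum_(y <- s) cond w x y <= \sum_(e <- star x) w e.
Proof.
move=> su; rewrite /cond exchange_big /= /star big_cat (big_map (fun i => (x, i))).
rewrite (big_map (fun i => (stp x i (-1), i))) /= -big_split /=.
rewrite big_enum /=; apply: ler_sum => i _; rewrite big_split /= lerD //.
  under eq_bigr do rewrite vadd_unitv.
  by apply: (@sum_dirac s _ (fun=> w (x, i))) => // _; apply: ltW.
under eq_bigr => y _.
  rewrite vadd_unitv (_ : (x == stp y i 1) = (y == stp x i (-1))); last first.
    apply/eqP/eqP => ->; rewrite stpD ?subrr ?addNr stp0 //.
  over.
by apply: (@sum_dirac s _ (fun y => w (y, i))) => // y; apply: ltW.
Qed.

(** [(1_x(u) - 1_x(v))^2 <= 1_x(u) + 1_x(v)]; the two terms compensate the factor [1/2]. *)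
Lemma energy_dirac n x : energy w n (dirac_fun x) <= \sum_(e <- star x) w e.
Proof.
set A := \sum_(e <- _) _.
apply: le_trans (_ : 2^-1 * (A + A) <= _); last by lra.
rewrite /energy ler_wpM2l ?invr_ge0 //.
apply: le_trans (_ : \sum_(u <- box d n.+1) \sum_(v <- box d n.+2)
   ((u == x)%:R * cond w u v + (v == x)%:R * cond w u v) <= _).
  apply: ler_sum => u _; rewrite [leLHS]big_mkcond; apply: ler_sum => v _.
  rewrite -mulrDl; case: ifP => _; last by rewrite mulr_ge0 ?addr_ge0 ?cond_ge0.
  rewrite mulrC ler_wpM2r ?cond_ge0 // /dirac_fun.
  case: (u == x); case: (v == x); rewrite ?subrr ?subr0 ?sub0r ?sqrrN ?expr0n ?expr1n //=;
    by rewrite ?addr0 ?add0r ?addr_ge0.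
under eq_bigr do rewrite big_split /=.
rewrite big_split /= lerD //.
  under eq_bigr do rewrite -mulr_sumr.
  apply: le_trans (@sum_dirac _ x (fun u => \sum_(v <- box d n.+2) cond w u v) _ _) _.
  - exact: box_uniq.
  - by move=> y; apply: sumr_ge0 => v _; apply: cond_ge0.
  - exact/sum_cond/box_uniq.
apply: le_trans (_ : \sum_(u <- box d n.+1) cond w x u <= _); last exact/sum_cond/box_uniq.
apply: ler_sum => u _; rewrite condC.
by apply: (@sum_dirac _ _ (fun v => cond w u v)); rewrite ?box_uniq // => y; apply: cond_ge0.
Qed.

Lemma lambda1_ge n c :
  (forall f, (forall x, ~~ in_box n x -> f x = 0) ->
     \sum_(x <- box d n) f x ^+ 2 = 1 -> c <= energy w n f) ->
  c <= lambda1 w n.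
Proof.
move=> h; apply: lb_le_inf; last by move=> _ [f [f1 f2] <-]; apply: h.
(* The infimum needs a nonempty set: the Dirac mass at the origin is admissible. *)
exists (energy w n (dirac_fun [ffun=> 0])); exists (dirac_fun [ffun=> 0]) => //=.
by apply: dirac_admissible; apply/in_boxP => j; rewrite ffunE; lia.
Qed.

Lemma lambda1_ge0 n : 0 <= lambda1 w n.
Proof. by apply: lambda1_ge => f _ _; apply: energy_ge0. Qed.

Lemma lambda1_le_star n x : in_box n x -> lambda1 w n <= \sum_(e <- star x) w e.
Proof.
move=> xn; apply: le_trans (energy_dirac n x); apply: ge_inf.
  by exists 0 => _ [f _ <-]; apply: energy_ge0.
by exists (dirac_fun x) => //=; apply: dirac_admissible.
Qed.

End Eigenvalue.
End Environment.

(** * Probability estimates *)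

Section Probability.
Context (R : realType) (d : nat) (dT : measure_display) (T : measurableType dT)
  (P : probability T R) (W : edge d -> T -> R) (mu : probability R R).

Definition cdfmu (a : R) : R := fine (mu `]-oo, a]%classic).

Lemma cdfmuE a : mu `]-oo, a]%classic = (cdfmu a)%:E.
Proof. by rewrite /cdfmu fineK // fin_num_measure. Qed.

Lemma cdfmu_ge0 a : 0 <= cdfmu a.
Proof. exact: fine_ge0. Qed.

Lemma cdfmu_le1 a : cdfmu a <= 1.
Proof. by rewrite -lee_fin -cdfmuE probability_le1. Qed.

Lemma cdfmu_le a b : a <= b -> cdfmu a <= cdfmu b.
Proof.
move=> ab; rewrite -lee_fin -!cdfmuE le_measure ?inE //.
by move=> x; rewrite /= !in_itv /= => /le_trans; apply.
Qed.

Lemma union_bound (I : eqType) (s : seq I) (A : I -> T -> bool) (b : I -> R) :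
  (forall i, measurable [set om | A i om]) ->
  (forall i, i \in s -> (P [set om | A i om] <= (b i)%:E)%E) ->
  measurable [set om | has (A^~ om) s] /\
  (P [set om | has (A^~ om) s] <= (\sum_(i <- s) b i)%:E)%E.
Proof.
move=> mA; elim: s => [|i s IH] Pb.
  have -> : [set om | has (A^~ om) [::]] = set0 by apply/seteqP; split.
  by rewrite big_nil measure0; split.
have -> : [set om | has (A^~ om) (i :: s)] = [set om | A i om] `|` [set om | has (A^~ om) s].
  by apply/seteqP; split=> om /= => [/orP[]|[]] h; [left|right| |];
    rewrite ?h ?orbT.
have [mI PI] := IH (fun j js => Pb j (mem_behead (s := i :: s) js)).
split; first exact: measurableU.
rewrite big_cons EFinD; apply: le_trans (measureU2 _ _ _) _ => //.
by apply: leeD => //; apply: Pb; rewrite mem_head.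
Qed.

Hypothesis mW : forall e, measurable_fun setT (W e).
Hypothesis lawW : forall e (A : set R), measurable A -> P (W e @^-1` A) = mu A.
Hypothesis indW : mutually_independent P W.

Lemma measurable_closed e a : measurable [set om | W e om <= a].
Proof.
have -> : [set om | W e om <= a] = setT `&` W e @^-1` `]-oo, a]%classic.
  by rewrite setTI; apply/seteqP; split=> om /=; rewrite in_itv.
exact: mW.
Qed.

Lemma measurable_all (I : Type) (s : seq I) (A : I -> T -> bool) :
  (forall i, measurable [set om | A i om]) -> measurable [set om | all (A^~ om) s].
Proof.
move=> mA; elim: s => [|i s IH].
  by have -> : [set om | all (A^~ om) [::]] = setT by apply/seteqP; split.
have -> : [set om | all (A^~ om) (i :: s)] = [set om | A i om] `&` [set om | all (A^~ om) s].
  by apply/seteqP; split=> om /=; [move=> /andP|move=> [-> ->]].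
exact: measurableI.
Qed.

(** Independence is stated for events indexed by all edges; this extends a list of thresholds to
    such a family. *)
Lemma level_function (Es : seq (edge d * R)) : uniq (map fst Es) ->
  exists lev : edge d -> R, forall q, q \in Es -> lev q.1 = q.2.
Proof.
elim: Es => [|q Es IH] /=; first by exists (fun=> 0).
move=> /andP[qEs /IH[lev levE]]; exists (fun e => if e == q.1 then q.2 else lev e).
move=> r; rewrite inE => /orP[/eqP->|rE]; first by rewrite eqxx.
case: eqP => [rq|_]; last exact: levE.
by case/negP: qEs; rewrite -rq map_f.
Qed.

Lemma prob_pairs (Es : seq (edge d * R)) : uniq (map fst Es) ->
  P [set om | all (fun q => W q.1 om <= q.2) Es] = (\prod_(q <- Es) cdfmu q.2)%:E.
Proof.
move=> Eu; have [lev levE] := level_function Eu.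
have := indW Eu (fun e => measurable_itv `]-oo, (lev e)]).
have -> : \bigcap_(i in [set` map fst Es]) W i @^-1` `]-oo, (lev i)]%classic =
    [set om | all (fun q => W q.1 om <= q.2) Es].
  apply/seteqP; split=> om /= h.
    apply/allP => q qE; rewrite -levE //; have := h q.1 (map_f _ qE).
    by rewrite /= in_itv.
  move=> e /= /mapP[q qE ->]; rewrite levE // in_itv /=; exact: (allP h).
move=> ->; rewrite big_map -prodEFin; apply: eq_big_seq => q qE.
by rewrite lawW // cdfmuE levE.
Qed.

Lemma prob_all_closed a V : uniq V ->
  P [set om | all (fun e => W e om <= a) V] = (cdfmu a ^+ size V)%:E.
Proof.
move=> Vu; have := @prob_pairs [seq (e, a) | e <- V].
rewrite -map_comp map_id => /(_ Vu); rewrite big_map /= big_const_seq count_predT.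
rewrite iter_mulr_1 => <-; congr (P _); apply/seteqP; split=> om /=;
  by rewrite all_map.
Qed.

Lemma prob_has_closed a v (Vs : seq (seq (edge d))) :
  (forall V, V \in Vs -> uniq V /\ size V = v) ->
  measurable [set om | has_closed (fun e => W e om <= a) Vs] /\
  (P [set om | has_closed (fun e => (W e om <= a)%R) Vs] <=
    ((size Vs)%:R * cdfmu a ^+ v)%:E)%E.
Proof.
move=> VsP.
have [||mU PU] := @union_bound _ Vs (fun V om => all (fun e => W e om <= a) V)
  (fun=> cdfmu a ^+ v).
- by move=> V; apply: measurable_all => e; apply: measurable_closed.
- by move=> V /VsP[Vu <-]; rewrite prob_all_closed.
by split=> //; rewrite big_const_seq count_predT iter_addr_0 -mulr_natl in PU.
Qed.

Definition block_closed (q : seq (edge d) * R) om := all (fun e => W e om <= q.2) q.1.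

Definition block_prob (q : seq (edge d) * R) := cdfmu q.2 ^+ size q.1.

Lemma measurable_block q : measurable [set om | block_closed q om].
Proof. by apply: measurable_all => e; apply: measurable_closed. Qed.

Lemma prob_blocks_closed (Ls : seq (seq (edge d) * R)) : uniq (flatten (map fst Ls)) ->
  P [set om | all (block_closed^~ om) Ls] = (\prod_(q <- Ls) block_prob q)%:E.
Proof.
move=> Lu; pose Es := flatten [seq [seq (e, q.2) | e <- q.1] | q <- Ls].
have EsE : map fst Es = flatten (map fst Ls).
  rewrite /Es map_flatten -map_comp; congr flatten; apply: eq_map => q /=.
  by rewrite -map_comp map_id.
have := @prob_pairs Es; rewrite EsE => /(_ Lu).
rewrite /Es big_flatten /= big_map => PE.
rewrite (_ : \prod_(q <- Ls) block_prob q =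
  \prod_(i <- Ls) \prod_(i0 <- [seq (e, i.2) | e <- i.1]) cdfmu i0.2); last first.
  by apply: eq_bigr => q _; rewrite big_map /= big_const_seq count_predT iter_mulr_1.
rewrite -PE; congr (P _); apply/seteqP; split=> om /= /allP h; apply/allP => q.
  by move=> /flattenP[s /mapP[r rL ->] /mapP[e er ->]] /=; apply: (allP (h r rL)).
move=> qL; apply/allP => e eq; apply: (h (e, q.2)); apply/flattenP.
by exists [seq (e, q.2) | e <- q.1]; apply: map_f.
Qed.

(** Induction on [Ns] by the probability of a difference of events: the block [q] is once dropped
    and once moved to the closed list. *)
Lemma prob_blocks (Ns Ls : seq (seq (edge d) * R)) :
  uniq (flatten (map fst (Ls ++ Ns))) ->
  P [set om | all (block_closed^~ om) Ls && all (fun q => ~~ block_closed q om) Ns] =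
  (\prod_(q <- Ls) block_prob q * \prod_(q <- Ns) (1 - block_prob q))%:E.
Proof.
have mS (L N : seq (seq (edge d) * R)) :
    measurable [set om | all (block_closed^~ om) L && all (fun q => ~~ block_closed q om) N].
  rewrite (_ : [set om | _] = [set om | all (block_closed^~ om) L] `&`
     [set om | all (fun q => ~~ block_closed q om) N]); last first.
    by apply/seteqP; split=> om /=; [move=> /andP|move=> [-> ->]].
  apply: measurableI; first by apply: measurable_all => q; apply: measurable_block.
  apply: (@measurable_all _ _ (fun q om => ~~ block_closed q om)) => q.
  rewrite (_ : [set om | _] = ~` [set om | block_closed q om]); last first.
    by apply/seteqP; split=> om /= /negP.
  exact/measurableC/measurable_block.
elim: Ns Ls => [|q Ns IH] Ls Lu.
  rewrite big_nil mulr1 -prob_blocks_closed; last by rewrite cats0 in Lu.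
  by congr (P _); apply/seteqP; split=> om /=; rewrite andbT.
have u1 : uniq (flatten [seq i.1 | i <- Ls ++ Ns]).
  apply: subseq_uniq Lu; rewrite !map_cat !flatten_cat; apply: cat_subseq => //.
  exact: suffix_subseq.
have u2 : uniq (flatten [seq i.1 | i <- (q :: Ls) ++ Ns]).
  move: Lu; rewrite !map_cat !flatten_cat /= -catA; apply: etrans.
  by rewrite uniq_catCA.
rewrite (_ : [set om | _] =
    [set om | all (block_closed^~ om) Ls && all (fun q => ~~ block_closed q om) Ns] `\`
    [set om | all (block_closed^~ om) (q :: Ls) && all (fun q => ~~ block_closed q om) Ns]);
  last first.
  apply/seteqP; split=> om /=.
    by move=> /and3P[-> /negbTE-> ->].
  by move=> [/andP[-> ->]]; rewrite !andbT => /negP.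
rewrite measureD //; last by rewrite -ge0_fin_numE // fin_num_measure.
rewrite setIC setIidl; last by move=> om /= /andP[/andP[_ ->] ->].
apply: etrans (congr2 (fun a b => a - b)%E (IH Ls u1) (IH (q :: Ls) u2)) _.
by rewrite -EFinB !big_cons; congr EFin; ring.
Qed.

(** An algebraic substitute for [1 - b <= exp(-b)]: a divergent sum still forces the product to
    zero. *)
Lemma prod_le_inv_sum (I : Type) (s : seq I) (b : I -> R) :
  (forall i, 0 <= b i <= 1) ->
  \prod_(i <- s) (1 - b i) * (1 + \sum_(i <- s) b i) <= 1.
Proof.
move=> b01; elim: s => [|i s IH]; first by rewrite !big_nil addr0 mulr1.
rewrite !big_cons; have /andP[b0 b1] := b01 i.
set X := \prod_(j <- s) _ in IH *; set S := \sum_(j <- s) _ in IH *.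
have X0 : 0 <= X by apply: prodr_ge0 => j _; have /andP[_] := b01 j; rewrite subr_ge0.
have X1 : X <= 1.
  have S0 : 0 <= S by apply: sumr_ge0 => j _; have /andP[] := b01 j.
  by nra.
have h : X * (1 + S) + b i * X <= 1 + b i by nra.
nra.
Qed.

(** The second Borel-Cantelli lemma, for blocks on disjoint sets of edges. *)
Lemma blocks_infinitely_often (blk : nat -> seq (seq (edge d) * R)) :
  (forall K M, uniq (flatten (map fst (flatten [seq blk k | k <- index_iota K M])))) ->
  (forall K (B : R), exists M,
     B <= \sum_(K <= k < M) \sum_(q <- blk k) block_prob q) ->
  {ae P, forall om, forall K, exists2 k, (K <= k)%N & has (block_closed^~ om) (blk k)}.
Proof.
move=> bu bdiv; apply: ae_foralln => K.
pose NN M := [set om | all (fun q => ~~ block_closed q om)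
   (flatten [seq blk k | k <- index_iota K M])].
have mNN M : measurable (NN M).
  apply: (@measurable_all _ _ (fun q om => ~~ block_closed q om)) => q.
  rewrite (_ : [set om | _] = ~` [set om | block_closed q om]); last first.
    by apply/seteqP; split=> om /= /negP.
  exact/measurableC/measurable_block.
exists (\bigcap_M NN M); split.
- exact: bigcapT_measurable.
- apply/eqP; rewrite eq_le measure_ge0 andbT; apply/lee_addgt0Pr => e e0; rewrite add0e.
  (* A sum of at least [1/e] makes the product at most [e]. *)
  have [M hM] := bdiv K e^-1.
  apply: le_trans (_ : P (NN M) <= _)%E.
    apply: le_measure; rewrite ?inE //; first exact: bigcapT_measurable.
    exact: bigcap_inf.
  have := @prob_blocks (flatten [seq blk k | k <- index_iota K M]) [::].
  move=> /(_ (bu K M)); rewrite big_nil mul1r => PE.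
  have -> : NN M = [set om | all (block_closed^~ om) [::] && all (fun q => ~~ block_closed q om)
      (flatten [seq blk k | k <- index_iota K M])] by [].
  rewrite PE lee_fin.
  have bp q : 0 <= block_prob q <= 1.
    by rewrite exprn_ge0 ?cdfmu_ge0 // exprn_ile1 ?cdfmu_ge0 ?cdfmu_le1.
  have := prod_le_inv_sum (flatten [seq blk k | k <- index_iota K M]) bp.
  rewrite big_flatten big_map [X in _ * (1 + X)]big_flatten [X in _ * (1 + X)]big_map.
  set X := \prod_(_ <- _) _; set S := \sum_(_ <- _) _ => XS.
  have S1 : e^-1 <= S by [].
  have ei : e * e^-1 = 1 by rewrite divff // gt_eqF.
  have S0 : 0 < S by apply: lt_le_trans S1; rewrite invr_gt0.
  have : e * e^-1 <= e * S by rewrite ler_wpM2l // ltW.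
  rewrite ei => eS.
  have X0 : 0 <= X by apply: prodr_ge0 => k _; apply: prodr_ge0 => q _; have /andP[] := bp q; lra.
  have h1 : X * 1 <= X * (e * S) by rewrite ler_wpM2l.
  have h2 : e * (X * (1 + S)) <= e * 1 by rewrite ler_wpM2l // ltW.
  by nra.
- move=> om h M _ /=; apply/allP => q /flattenP[s /mapP[k kKM ->] qs].
  apply/negP => qc; apply: h; exists k; first by move: kKM; rewrite mem_index_iota => /andP[].
  by apply/hasP; exists q.
Qed.

End Probability.

(** * The rate function *)

Section RateFunction.
Context {R : realType}.
Variable g : R -> R.
Hypothesis g0 : forall u : R, 0 < u -> 0 < g u.
Hypothesis gd : forall u v : R, 0 < u -> u <= v -> g v <= g u.

Lemma leq_pow2_scale (u v : R) : 0 < u -> exists k : nat, v <= 2 ^+ k * u.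
Proof.
move=> u0; have [n hn] : exists n : nat, v / u < n%:R.
  by exists (Num.truncn (v / u)).+1; rewrite truncnS_gt.
exists n; rewrite -ler_pdivrMr //; apply/ltW/(lt_le_trans hn).
by rewrite -natrX ler_nat ltnW // ltn_expl.
Qed.

(** Halve [v] until it is at most [2u]: the doubling hypothesis pays for each halving, and
    monotonicity covers the rest at the cost [4]. *)
Lemma growth_of_doubling u0 : 0 < u0 -> (forall u : R, u0 <= u -> g (2 * u) <= g u / 4) ->
  forall u v : R, u0 <= u -> u <= v -> v ^+ 2 * g v <= 4 * (u ^+ 2 * g u).
Proof.
move=> u00 dbl u v u0u; have up : 0 < u by apply: lt_le_trans u0u.
have [k] := leq_pow2_scale v up; elim: k v => [|k IH] v vk uv.
  have -> : v = u by apply/eqP; rewrite eq_le uv andbT; move: vk; rewrite expr0 mul1r.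
  have := g0 up; have : 0 <= u ^+ 2 by rewrite sqr_ge0.
  by move=> *; nra.
have gu := g0 up; have gv : g v <= g u by apply: gd.
have gv0 : 0 < g v by apply: g0; lra.
have [v2|v2] := leP v (2 * u).
  have h : v ^+ 2 <= 4 * u ^+ 2 by nra.
  by rewrite mulrA; apply: ler_pM => //; rewrite ?sqr_ge0 // ltW.
have h1 : v / 2 <= 2 ^+ k * u by move: vk; rewrite exprS; lra.
have h2 : u <= v / 2 by lra.
have := IH _ h1 h2; apply: le_trans.
have := dbl (v / 2) (le_trans u0u h2); rewrite mulrCA divff ?pnatr_eq0 // mulr1 => hg.
have v0 : 0 <= v ^+ 2 by rewrite sqr_ge0.
by nra.
Qed.

Lemma rate_growth :
  (exists rho : R, rho < -2 /\ regularly_varying g rho) \/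
  (monotone_on_pos (fun u => u ^+ 2 * g u) /\
    exists l : R, (fun u => u ^+ 2 * g u) x @[x --> +oo] --> l) ->
  exists C u0 : R, [/\ 0 < C, 0 < u0 &
    forall u v : R, u0 <= u -> u <= v -> v ^+ 2 * g v <= C * (u ^+ 2 * g u)].
Proof.
case=> [[rho [rho2 [L [gL Lcvg]]]]|[mon [l hl]]].
  (* An index below [-2] gives [4 * 2^rho < 1]; the inverse [c > 1] is the room left for
     [L(2u)/L(u)], which tends to [1]. *)
  pose c : R := (4 * 2 `^ rho)^-1.
  have p0 : 0 < (2 : R) `^ rho by rewrite powR_gt0.
  have c1 : 1 < c.
    rewrite invf_gt1; last by rewrite mulr_gt0.
    pose s : R := - rho - 2.
    have s0 : 0 < s by rewrite /s; lra.
    have s1 : 1 < (2 : R) `^ s.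
      have := @gt0_ltr_powR R s s0 1 2; rewrite powR1 !nnegrE; apply=> //.
      exact: ltr1n.
    rewrite (_ : rho = - (s + 2%:R)); last by rewrite /s; lra.
    rewrite powRN powRD; last by rewrite pnatr_eq0 implybT.
    rewrite powR_mulrn // ltr_pdivrMr ?mulr_gt0 ?exprn_gt0 ?powR_gt0 //.
    lra.
  have two0 : 0 < (2 : R) by [].
  have [M [Mr hM]] := cvgr_lt _ (Lcvg 2 two0) _ c1.
  pose u0 := Num.max 1 (M + 1).
  have u01 : 1 <= u0 by rewrite le_max lexx.
  have u0M : M + 1 <= u0 by rewrite le_max lexx orbT.
  exists 4, u0; split=> //; first lra.
  apply: growth_of_doubling; first lra.
  move=> u u0u; have up : 0 < u by lra.
  have uM : M < u by lra.
  have u2 : 0 < 2 * u by lra.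
  have Lu : 0 < L u by have := g0 up; rewrite gL // pmulr_rgt0 ?powR_gt0.
  have := hM u uM; rewrite /= ltr_pdivrMr // => /ltW h.
  rewrite !gL // powRM ?(ltW up) //.
  have uu : 0 < u `^ rho by rewrite powR_gt0.
  rewrite (_ : u `^ rho * L u / 4 = 2 `^ rho * u `^ rho * (c * L u)); last first.
    by rewrite /c; field; rewrite gt_eqF.
  by rewrite ler_wpM2l // mulr_ge0 // ltW.
have h1 : 0 < (1 : R) ^+ 2 * g 1 by rewrite expr1n mul1r g0.
(* If [u^2 g(u)] is nonincreasing, [C = 1] works; if nondecreasing, it lies beyond [1] between its
   value at [1] and its limit [l], and [C] is their ratio. *)
case: mon => mon; last first.
  exists 1, 1; split=> // u v u1 uv; rewrite mul1r; apply: mon => //; lra.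
have hle v : 0 < v -> v ^+ 2 * g v <= l.
  move=> v0; rewrite leNgt; apply/negP => lv.
  have [M [_ hM]] := cvgr_lt _ hl _ lv.
  pose x := Num.max v (M + 1).
  have xv : v <= x by rewrite le_max lexx.
  have xM : M + 1 <= x by rewrite le_max lexx orbT.
  have xM' : M < x by lra.
  have := hM x xM'; rewrite ltNge => /negP; apply.
  exact: mon.
have l0 : 0 < l by apply: lt_le_trans h1 (hle 1 _).
exists (l / (1 ^+ 2 * g 1)), 1; split=> //; first by rewrite divr_gt0.
move=> u v u1 uv; have v0 : 0 < v by lra.
apply: le_trans (hle v v0) _; rewrite mulrAC ler_pdivlMr // ler_wpM2l ?(ltW l0) //.
exact: mon.
Qed.

End RateFunction.

(** * The integral of [Lambda(u)/u] against dyadic sums *)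

Section DyadicIntegral.
Context {R : realType}.
Variables (d : nat) (q : R -> R).
Hypothesis d0 : (0 < d)%N.
Hypothesis q01 : forall u : R, 0 <= q u <= 1.
Hypothesis qd : forall u v : R, 0 < u -> u <= v -> q v <= q u.

Let F (u : R) : R := u^-1 * (u ^+ d * q u ^+ (2 * d)).
Let Lam (u : R) : R := u ^+ d * q u ^+ (2 * d).

Lemma FE (u : R) : 0 < u -> F u = u ^+ d.-1 * q u ^+ (2 * d).
Proof.
move=> u0; rewrite /F mulrA -(prednK d0) exprS mulrA mulVf ?mul1r ?gt_eqF //.
Qed.

Lemma F_ge0 (u : R) : 0 < u -> 0 <= F u.
Proof.
by move=> u0; rewrite FE // mulr_ge0 ?exprn_ge0 ?(ltW u0) //; have /andP[] := q01 u.
Qed.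

Lemma measurable_F : measurable_fun (`]0%R, +oo[%classic : set R) F.
Proof.
(* Extended by [1] to the nonpositive reals, [q] is monotone on the whole line, hence measurable. *)
pose q' (u : R) : R := if 0 < u then q u else 1.
have mq' : measurable_fun setT q'.
  apply: nonincreasing_measurable => // u v uv; rewrite /q'.
  have /andP[? ?] := q01 v.
  by case: ifPn => v0; case: ifPn => uu0 //; [apply: qd|move: v0 uu0; lra].
apply: (@eq_measurable_fun _ _ R R _ (fun u : R => u ^+ d.-1 * q' u ^+ (2 * d))).
  move=> u; rewrite inE /= in_itv /= andbT => u0; rewrite FE // /q' u0 //.
apply: measurable_funTS; apply: measurable_funM; apply: measurable_funX => //.
Qed.

Definition dyadic (k : nat) : set R := `]2 ^+ k, 2 ^+ k.+1]%classic.

Lemma dyadic_cover : `]0%R, +oo[%classic = `]0%R, 1%R]%classic `|` \bigcup_k dyadic k :> set R.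
Proof.
apply/seteqP; split=> u /=; rewrite ?in_itv /= ?andbT.
  move=> u0; have [u1|u1] := leP u 1; first by left; rewrite u0.
  right; have [n hn] := @leq_pow2_scale R 1 u ltr01; rewrite mulr1 in hn.
  have ex : exists n, u <= 2 ^+ n by exists n.
  case: (ex_minnP ex) => -[|m] hm mmin; first by move: hm; rewrite expr0; lra.
  exists m => //=; rewrite /dyadic /= in_itv /= hm andbT ltNge.
  by apply/negP => /mmin; rewrite ltnn.
case=> [|[k _]]; first by case/andP.
rewrite /dyadic /= in_itv /= => /andP[h _]; apply: lt_trans h; exact: exprn_gt0.
Qed.

Lemma trivIset_dyadic : trivIset setT dyadic.
Proof.
apply/trivIsetP => i j _ _; wlog ij : i j / (i < j)%N.
  move=> h ij; have [lt|lt|e] := ltngtP i j; first exact: h.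
    by rewrite setIC; apply: h; rewrite // eq_sym.
  by rewrite e eqxx in ij.
move=> _; apply/seteqP; split=> // u [] /=; rewrite /dyadic /= !in_itv /=.
move=> /andP[_ h1] /andP[h2 _]; have : (2 : R) ^+ i.+1 <= 2 ^+ j.
  by rewrite ler_eXn2l // ltr1n.
lra.
Qed.

Lemma integral_dyadic : (\int[lebesgue_measure]_(u in `]0%R, +oo[) (F u)%:E =
  \int[lebesgue_measure]_(u in `]0%R, 1%R]) (F u)%:E +
  \sum_(0 <= k <oo) \int[lebesgue_measure]_(u in dyadic k) (F u)%:E)%E.
Proof.
have cov := dyadic_cover.
have mD : measurable (\bigcup_k dyadic k) by apply: bigcup_measurable => k _; exact: measurable_itv.
have sub2 : \bigcup_k dyadic k `<=` `]0%R, +oo[%classic by rewrite cov; right.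
rewrite {1}cov ge0_integral_setU //; last 3 first.
- by apply/measurable_EFinP; rewrite -cov; exact: measurable_F.
- by move=> u; rewrite -cov /= in_itv /= andbT lee_fin => /F_ge0.
- apply/disj_setPS => u [] /=; rewrite in_itv /= => /andP[_ u1] [k _].
  rewrite /dyadic /= in_itv /= => /andP[h _].
  by have : (1 : R) <= 2 ^+ k; [rewrite exprn_ege1 // ler1n|lra].
congr (_ + _)%E; apply: ge0_integral_bigcup.
- by move=> k; exact: measurable_itv.
- by apply/measurable_EFinP; apply: measurable_funS measurable_F.
- by move=> u /sub2; rewrite /= in_itv /= andbT lee_fin => /F_ge0.
- exact: trivIset_dyadic.
Qed.

Lemma integral_itv_cst (a b c : R) : a <= b ->
  (\int[lebesgue_measure]_(u in `]a, b]) c%:E = (c * (b - a))%:E)%E.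
Proof.
move=> ab; rewrite integral_cst //= lebesgue_measure_itv /= lte_fin.
case: ltP => h; first by rewrite -EFinB -EFinM.
by rewrite mule0 (_ : b = a) ?subrr ?mulr0 //; apply/eqP; rewrite eq_le h ab.
Qed.

(** The factors of [u^(d-1) q(u)^(2d)] are monotone in opposite directions, so each bound evaluates
    them at opposite endpoints of an interval of length [2^k]. *)
Lemma dyadic_bounds k :
  ((Lam (2 ^+ k.+1) / 2 ^+ d)%:E <= \int[lebesgue_measure]_(u in dyadic k) (F u)%:E)%E /\
  (\int[lebesgue_measure]_(u in dyadic k) (F u)%:E <= (2 ^+ d * Lam (2 ^+ k))%:E)%E.
Proof.
have pk : 0 < (2 : R) ^+ k by exact: exprn_gt0.
have lk : (2 : R) ^+ k <= 2 ^+ k.+1 by rewrite exprS; lra.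
have sub : dyadic k `<=` `]0%R, +oo[%classic by rewrite dyadic_cover => u h; right; exists k.
have mF : measurable_fun (dyadic k) F.
  by apply: measurable_funS measurable_F.
have dist : (2 : R) ^+ k.+1 - 2 ^+ k = 2 ^+ k by rewrite exprS; lra.
have E (a : R) : a ^+ d = a ^+ d.-1 * a by rewrite -exprSr prednK.
split.
  rewrite (_ : Lam _ / _ = (2 ^+ k) ^+ d.-1 * q (2 ^+ k.+1) ^+ (2 * d) * (2 ^+ k.+1 - 2 ^+ k)).
    rewrite -integral_itv_cst //; apply: ge0_le_integral => //; try exact/measurable_EFinP.
    - move=> u _; rewrite lee_fin mulr_ge0 ?exprn_ge0 ?(ltW pk) //.
      by have /andP[] := q01 (2 ^+ k.+1).
    - move=> u; rewrite /dyadic /= in_itv /= => /andP[u1 u2]; have u0 : 0 < u by lra.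
      rewrite lee_fin FE //; apply: ler_pM; rewrite ?exprn_ge0 ?(ltW pk) //.
      + by have /andP[] := q01 (2 ^+ k.+1).
      + by rewrite lerXn2r ?nnegrE ?ltW.
      + have /andP[? _] := q01 (2 ^+ k.+1); have /andP[? _] := q01 u.
        by rewrite lerXn2r ?nnegrE // qd.
  rewrite dist /Lam; move: (q _ ^+ _) => Q; rewrite exprS exprMn (E (2 ^+ k)); field.
  by rewrite expf_neq0.
(* The spare factor [2] rounds [2^(d-1)] up to [2^d]. *)
rewrite (_ : 2 ^+ d * _ = 2 ^+ k.+1 ^+ d.-1 * (2 * q (2 ^+ k) ^+ (2 * d)) * (2 ^+ k.+1 - 2 ^+ k)).
  rewrite -integral_itv_cst //; apply: ge0_le_integral => //; try exact/measurable_EFinP; try exact: measurable_itv.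
  - by move=> u /sub; rewrite /= in_itv /= andbT lee_fin => /F_ge0.
  - move=> u; rewrite /dyadic /= in_itv /= => /andP[u1 u2]; have u0 : 0 < u by lra.
    have /andP[? _] := q01 (2 ^+ k); have /andP[? _] := q01 u.
    have qq : q u ^+ (2 * d) <= q (2 ^+ k) ^+ (2 * d) by rewrite lerXn2r ?nnegrE // qd // ltW.
    have q0 : 0 <= q (2 ^+ k) ^+ (2 * d) by rewrite exprn_ge0.
    rewrite lee_fin FE //; apply: ler_pM; rewrite ?exprn_ge0 ?(ltW u0) //.
      by rewrite lerXn2r ?nnegrE ?(ltW u0) // exprn_ge0.
    lra.
rewrite dist /Lam; move: (q _ ^+ _) => Q; rewrite exprS exprMn (E 2) (E (2 ^+ k)); ring.
Qed.

Lemma dyadic_sum_bounded : (\int[lebesgue_measure]_(u in `]0%R, +oo[) (F u)%:E < +oo)%E ->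
  exists B : R, forall n, \sum_(0 <= k < n) Lam (2 ^+ k) <= B.
Proof.
rewrite integral_dyadic; set I0 := (X in (X + _)%E); set S := (X in (_ + X)%E).
have Fk0 k : (0 <= \int[lebesgue_measure]_(u in dyadic k) (F u)%:E)%E.
  apply: integral_ge0 => u h; have : `]0%R, +oo[%classic u by rewrite dyadic_cover; right; exists k.
  by rewrite /= in_itv /= andbT lee_fin => /F_ge0.
have I00 : (0 <= I0)%E.
  by apply: integral_ge0 => u; rewrite /= in_itv /= => /andP[u0 _]; rewrite lee_fin F_ge0.
have S0 : (0 <= S)%E by apply: nneseries_ge0 => k _ _.
move=> fin; have Sfin : S \is a fin_num.
  rewrite ge0_fin_numE //; apply: le_lt_trans fin; exact: leeDr.
have Lam0 k : 0 <= Lam (2 ^+ k).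
  by rewrite mulr_ge0 ?exprn_ge0 //; have /andP[] := q01 (2 ^+ k).
(* Interval [k] controls the term [k+1], so the term at [1] is set apart. *)
exists (Lam 1 + 2 ^+ d * fine S) => n.
apply: le_trans (_ : \sum_(0 <= k < n.+1) Lam (2 ^+ k) <= _).
  by rewrite big_nat_recr //= lerDl.
rewrite big_nat_recl //= expr0 lerD2l -ler_pdivrMl ?exprn_gt0 // mulrC mulr_suml.
rewrite -lee_fin fineK // -sumEFin.
apply: le_trans (_ : \sum_(0 <= k < n) \int[lebesgue_measure]_(u in dyadic k) (F u)%:E <= _)%E.
  by apply: lee_sum => k _; have [] := dyadic_bounds k.
exact: nneseries_lim_ge.
Qed.

Lemma dyadic_sum_unbounded : (\int[lebesgue_measure]_(u in `]0%R, +oo[) (F u)%:E = +oo)%E ->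
  forall K (B : R), exists M, B <= \sum_(K <= k < M) Lam (2 ^+ k).
Proof.
rewrite integral_dyadic => inf K B; apply: contrapT => /forallNP h.
have Lam0 k : 0 <= Lam (2 ^+ k).
  by rewrite mulr_ge0 ?exprn_ge0 //; have /andP[] := q01 (2 ^+ k).
have bnd n : \sum_(0 <= k < n) Lam (2 ^+ k) <= \sum_(0 <= k < K) Lam (2 ^+ k) + B.
  apply: le_trans (_ : \sum_(0 <= k < maxn K n) Lam (2 ^+ k) <= _).
    rewrite (big_cat_nat (n := n) (p := maxn K n)) ?leq_maxr //= lerDl.
    by apply: sumr_ge0.
  rewrite (big_cat_nat (n := K)) ?leq_maxl //= lerD2l ltW // ltNge; exact/negP/h.
(* Near zero the integrand is at most [1], so divergence can only come from infinity. *)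
have : (\int[lebesgue_measure]_(u in `]0%R, 1%R]) (F u)%:E <= 1%:E)%E.
  rewrite (_ : 1%:E = (1 * (1 - 0))%:E); last by rewrite mul1r subr0.
  rewrite -integral_itv_cst //; apply: ge0_le_integral => //.
  - by move=> u; rewrite /= in_itv /= => /andP[u0 _]; rewrite lee_fin F_ge0.
  - apply/measurable_EFinP; apply: measurable_funS measurable_F => //; rewrite dyadic_cover; exact: subsetUl.
  - move=> u; rewrite /= in_itv /= => /andP[u0 u1]; rewrite lee_fin FE //.
    have /andP[? ?] := q01 u.
    by rewrite mulr_ile1 ?exprn_ge0 ?exprn_ile1 // ltW.
have : (\sum_(0 <= k <oo) \int[lebesgue_measure]_(u in dyadic k) (F u)%:E <=
   (2 ^+ d * (\sum_(0 <= k < K) Lam (2 ^+ k) + B))%:E)%E.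
  apply: lime_le.
    apply: is_cvg_nneseries => k _ _; apply: integral_ge0 => u hu.
    have : `]0%R, +oo[%classic u by rewrite dyadic_cover; right; exists k.
    by rewrite /= in_itv /= andbT lee_fin => /F_ge0.
  apply: nearW => n; apply: le_trans (_ : \sum_(0 <= k < n) (2 ^+ d * Lam (2 ^+ k))%:E <= _)%E.
    by apply: lee_sum => k _; have [] := dyadic_bounds k.
  by rewrite sumEFin lee_fin -mulr_sumr ler_wpM2l ?exprn_ge0.
move=> h1 h2; have := leeD h2 h1; rewrite inf -EFinD leye_eq => /eqP; by [].
Qed.

End DyadicIntegral.

(** * Polynomials against powers of two *)

(** Induction on [c]: of two factors [2^(k/2)] in [2^k], one absorbs the power [c], the other the
    remaining linear factor. *)
Lemma poly_le_exp2 (a b c : nat) :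
  exists k0, forall k, (k0 <= k)%N -> ((a * k + b) ^ c <= 2 ^ k)%N.
Proof.
have sq k : (k.+4 * k.+4 <= 2 ^ k.+4)%N.
  elim: k => // k; rewrite [(2 ^ k.+1.+4)%N]expnS; move: (2 ^ k.+4)%N => x; nia.
have lin a' b' k : (a' + b' + 4 <= k)%N -> (a' * k + b' <= 2 ^ k)%N.
  move=> h; have := sq (k - 4)%N; rewrite (_ : (k - 4).+4 = k); last by lia.
  by apply: leq_trans; nia.
elim: c a b => [|c IH] a b; first by exists 0%N => k _; rewrite expn0 expn_gt0.
have [k1 hk1] := IH (2 * a)%N (a + b)%N.
exists (2 * (k1 + (2 * a + (a + b) + 4)) + 1)%N => k hk.
have hj : (k <= k./2.*2.+1)%N by rewrite -{1}(odd_double_half k); case: odd; lia.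
have h1 := hk1 k./2 ltac:(lia); have h2 := lin (2 * a)%N (a + b)%N k./2 ltac:(lia).
have h3 : (a * k + b <= 2 * a * k./2 + (a + b))%N by nia.
apply: leq_trans (_ : (2 * a * k./2 + (a + b)) ^ c.+1 <= _)%N; first by rewrite leq_exp2r.
rewrite expnSr; apply: leq_trans (leq_mul h1 h2) _.
by rewrite -expnD leq_exp2l // addnn; have := odd_double_half k; lia.
Qed.

Lemma gap_numerics (d k1 : nat) : (0 < d)%N -> exists k0, forall k, (k0 <= k)%N ->
  let m := (d.+1 * k)%N in let L := (k1 ^ d + m ^ d)%N in
  (m ^ d + L.*2.+1 ^ d * m <= 2 ^ k)%N /\ (L ^ 2 * L.*2.+1 ^ d <= 2 ^ k)%N.
Proof.
(* The exponent collects [(d+3)d] for [(2L+1)^d] and [2(d+1)] for [L^2], by [L <= b^(d+1)] and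
   [2L+1 <= b^(d+3)]. *)
move=> d0; have [k0 hk0] := poly_le_exp2 d.+1 (k1 + 2) ((d + 3) * d + 2 * d + 2).
exists k0 => k /hk0; set b := (d.+1 * k + (k1 + 2))%N => hb m L.
have b2 : (2 <= b)%N by rewrite /b; lia.
have mb : (m <= b)%N by rewrite /b /m; lia.
have kb : (k1 <= b)%N by rewrite /b; lia.
have md : (m ^ d <= b ^ d)%N by rewrite leq_exp2r.
have kd : (k1 ^ d <= b ^ d)%N by rewrite leq_exp2r.
have bd0 : (0 < b ^ d)%N by rewrite expn_gt0; lia.
have Lb : (L <= b ^ d.+1)%N by rewrite /L expnS; nia.
have b8 : (8 <= b ^ 3)%N by rewrite (leq_exp2r 2 b (e := 3)).
have L2b : (L.*2.+1 <= b ^ (d + 3))%N by rewrite expnD /L; nia.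
have LL : (L.*2.+1 ^ d <= b ^ ((d + 3) * d))%N by rewrite expnM leq_exp2r.
have LL0 : (0 < b ^ ((d + 3) * d))%N by rewrite expn_gt0; lia.
split; apply: leq_trans hb.
  apply: leq_trans (_ : b ^ ((d + 3) * d + 2) <= _)%N; last by rewrite leq_exp2l; lia.
  have dd : (b ^ d <= b ^ ((d + 3) * d))%N by rewrite leq_exp2l; nia.
  apply: leq_trans (leq_add (leq_trans md dd) (leq_mul LL mb)) _.
  by rewrite expnD [(b ^ 2)%N]expnS expn1; move: (b ^ _)%N LL0 => X X0; nia.
have LL2 : (L ^ 2 <= b ^ (d.+1 * 2))%N by rewrite expnM leq_exp2r.
apply: leq_trans (leq_mul LL2 LL) _.
by rewrite -expnD leq_exp2l; lia.
Qed.

Lemma sum_half_powers (R : realType) (m n : nat) :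
  \sum_(m <= j < n) (2^-1 : R) ^+ j <= 2 * 2^-1 ^+ m.
Proof.
have [mn|nm] := leqP m n; last by rewrite big_geq ?mulr_ge0 ?exprn_ge0 ?invr_ge0 // ltnW.
suff : \sum_(m <= j < n) (2^-1 : R) ^+ j + 2 * 2^-1 ^+ n = 2 * 2^-1 ^+ m.
  move=> <-; rewrite lerDl mulr_ge0 ?exprn_ge0 ?invr_ge0 //.
rewrite -(subnK mn); elim: (n - m)%N => [|k IH]; first by rewrite big_geq ?add0r.
by rewrite addSn big_nat_recr ?leq_addl //= -IH exprS; field.
Qed.

Lemma uniq_flatten_map (I T : eqType) (s : seq I) (f : I -> seq T) :
  uniq s -> (forall x, uniq (f x)) ->
  (forall x y z, x \in s -> y \in s -> z \in f x -> z \in f y -> x = y) ->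
  uniq (flatten (map f s)).
Proof.
move=> + fu; elim: s => //= x s IH /andP[xs su] fi; rewrite cat_uniq fu IH //=; last first.
  by move=> a b c ha hb; apply: fi; rewrite inE ?ha ?hb orbT.
rewrite andbT; apply/hasPn => z /flattenP[_ /mapP[y ys ->]] zy; apply/negP => zx.
by move: xs; rewrite (fi x y z) ?ys // inE ?eqxx // ys orbT.
Qed.

(** * Sites with disjoint stars *)

Section Sites.
Variable d : nat.

(** Vertices with even coordinates in [[2^(k+1), 2^(k+2))]; distinct ones have
    disjoint stars. *)
Definition sites (k : nat) : seq (vtx d) :=
  [seq [ffun j => ((2 ^ k + a j) * 2)%N%:Z] | a : {ffun 'I_d -> 'I_(2 ^ k)}].

Lemma size_sites k : size (sites k) = ((2 ^ k) ^ d)%N.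
Proof. by rewrite size_map -cardE card_ffun !card_ord. Qed.

Lemma mem_sites k x : x \in sites k -> forall j, exists a : nat,
  x j = (a * 2)%N%:Z /\ (2 ^ k <= a < 2 ^ k.+1)%N.
Proof.
move=> /mapP[a _ ->] j; exists (2 ^ k + a j)%N; rewrite ffunE; split=> //.
by have := ltn_ord (a j); rewrite expnS; lia.
Qed.

Lemma sites_uniq k : uniq (sites k).
Proof.
rewrite map_inj_uniq ?enum_uniq // => a b /ffunP ab.
apply/ffunP => j; apply: val_inj; have := ab j; rewrite !ffunE /=.
by move=> [] /eqP; rewrite eqn_mul2r /= eqn_add2l => /eqP.
Qed.

Lemma sites_in_box k x : x \in sites k -> in_box (2 ^ k.+2) x.
Proof.
move=> /mem_sites h; apply/in_boxP => j; have [a [-> ha]] := h j.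
by move: ha; rewrite [(2 ^ k.+2)%N]expnS; lia.
Qed.

(** Along its own direction an edge joins an even coordinate to an odd one, so at most one endpoint
    has all coordinates even. *)
Lemma star_even_inj (x y : vtx d) e :
  (forall j, exists a : nat, x j = (a * 2)%N%:Z) ->
  (forall j, exists a : nat, y j = (a * 2)%N%:Z) ->
  e \in star x -> e \in star y -> x = y.
Proof.
move=> ex ey /mem_star hx /mem_star hy.
have [a ha] := ex e.2; have [b hb] := ey e.2.
case: hx hy => hx [] hy; rewrite -hx -hy // in ha hb *;
  by move: hb; rewrite ?ha; move: ha; rewrite stpE eqxx => ha hb; exfalso; lia.
Qed.

Lemma stars_uniq K M : (0 < d)%N ->
  uniq (flatten (map (@star d) (flatten [seq sites k | k <- index_iota K M]))).
Proof.
move=> d0; apply: uniq_flatten_map.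
- apply: uniq_flatten_map; rewrite ?iota_uniq //; first exact: sites_uniq.
  move=> k l x _ _ /mem_sites hk /mem_sites hl.
  have [a [xa ha]] := hk (Ordinal d0); have [b [xb hb]] := hl (Ordinal d0).
  have ab : a = b by move: xa; rewrite xb; lia.
  rewrite -{}ab in hb.
  have le1 i j : (2 ^ i <= a)%N -> (a < 2 ^ j.+1)%N -> (i <= j)%N.
    by move=> h1 h2; have := leq_ltn_trans h1 h2; rewrite ltn_exp2l.
  case/andP: ha => ha1 ha2; case/andP: hb => hb1 hb2.
  by apply/eqP; rewrite eqn_leq (le1 k l) // (le1 l k).
- exact: star_uniq.
- move=> x y e /flattenP[_ /mapP[k _ ->] /mem_sites hx] /flattenP[_ /mapP[l _ ->] /mem_sites hy].
  by apply: star_even_inj => j; [have [a []] := hx j|have [a []] := hy j]; exists a.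
Qed.

End Sites.

(** With [N = 2^(k+1)] the side [2(N+1)+1] is at most [8 * 2^k]; per edge, the walk contributes at
    most [(3^d d)^2] and the mask [2^2]. *)
Lemma size_animals_dyadic d k m v : (0 < d)%N ->
  (size (animals d (2 ^ k.+1) m v) <=
   d * 8 ^ d * (2 ^ k) ^ d * ((2 * (3 ^ d * d)) ^ 2) ^ m)%N.
Proof.
move=> d0; apply: leq_trans (size_animals d _ m v) _; rewrite -mulnA leq_mul //.
  rewrite size_EB mulnC -!mulnA leq_mul2l -expnMn leq_exp2r //; apply/orP; right.
  by have : (0 < 2 ^ k)%N by [rewrite expn_gt0]; rewrite expnS; lia.
have D1 : (0 < 3 ^ d * d)%N by rewrite muln_gt0 expn_gt0.
rewrite -expnM [X in (_ <= X)%N]expnMn [X in (_ <= X)%N]mulnC leq_mul //.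
  by rewrite leq_pexp2l //; lia.
by rewrite leq_exp2l //; lia.
Qed.

Lemma mem_animals_uniq d N m v V : V \in animals d N m v -> uniq V /\ size V = v.
Proof. by rewrite mem_filter => /andP[/andP[? /eqP]]. Qed.

(** * Divergent case: deep traps occur infinitely often *)

Section Main.
Context (R : realType) (d : nat) (dT : measure_display) (T : measurableType dT)
  (P : probability T R) (W : edge d -> T -> R) (mu : probability R R) (g : R -> R).
Hypothesis d2 : (2 <= d)%N.
Hypothesis mW : forall e, measurable_fun setT (W e).
Hypothesis W0 : forall e om, 0 < W e om.
Hypothesis lawW : forall e (A : set R), measurable A -> P (W e @^-1` A) = mu A.
Hypothesis indW : mutually_independent P W.
Hypothesis g0 : forall u : R, 0 < u -> 0 < g u.
Hypothesis gd : forall u v : R, 0 < u -> u <= v -> g v <= g u.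
Variables C u0 : R.
Hypothesis C0 : 0 < C.
Hypothesis u00 : 0 < u0.
Hypothesis growth : forall u v, u0 <= u -> u <= v ->
  v ^+ 2 * g v <= C * (u ^+ 2 * g u).

Let d0 : (0 < d)%N := ltnW d2.
Let q (u : R) : R := cdfmu mu (g u).

Let q01 u : 0 <= q u <= 1.
Proof. by rewrite cdfmu_ge0 cdfmu_le1. Qed.

Let qd u v : 0 < u -> u <= v -> q v <= q u.
Proof. by move=> uu uv; apply/cdfmu_le/gd. Qed.

Let two_gt0 k : 0 < (2 : R) ^+ k.
Proof. exact: exprn_gt0. Qed.

Lemma pow2_ge (u : R) : exists k0, forall k, (k0 <= k)%N -> u <= 2 ^+ k.
Proof.
have [k0 hk] := @leq_pow2_scale R 1 u ltr01; exists k0 => k kk; rewrite mulr1 in hk.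
by apply: le_trans hk _; rewrite ler_weXn2l // ler1n.
Qed.

(** Trades a small factor [eps] for a fixed dyadic shift [c], so that the divergence assumed for [g]
    carries over to [eps g]. *)
Lemma rate_decay (eps : R) : 0 < eps ->
  exists c, forall u, u0 <= u -> g (2 ^+ c * u) <= eps * g u.
Proof.
move=> eps0; have [c hc] := pow2_ge (C / eps); exists c => u uu.
have up : 0 < u by apply: lt_le_trans uu.
have c1 : (1 : R) <= 2 ^+ c by rewrite exprn_ege1 // ler1n.
have := growth uu (ler_peMl (ltW up) c1); rewrite exprMn => h.
have gu := g0 up; have gv : 0 < g (2 ^+ c * u) by apply: g0; rewrite mulr_gt0.
have u2 : 0 < u ^+ 2 by rewrite exprn_gt0.
have h' : (2 ^+ c) ^+ 2 * g (2 ^+ c * u) <= C * g u.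
  by rewrite -(ler_pM2l u2) mulrA [_ * (2 ^+ c) ^+ 2]mulrC [leRHS]mulrCA.
have hc' : C <= 2 ^+ c * eps by have := hc c (leqnn c); rewrite ler_pdivrMr.
have h1 : 2 ^+ c * g (2 ^+ c * u) <= (2 ^+ c) ^+ 2 * g (2 ^+ c * u).
  by rewrite ler_wpM2r ?(ltW gv) // expr2 ler_peMl // ltW.
have h2 : C * g u <= 2 ^+ c * (eps * g u) by rewrite mulrA ler_wpM2r // ltW.
rewrite -(ler_pM2l (two_gt0 c)); apply: le_trans h1 _; exact: le_trans h' h2.
Qed.

Lemma trap_blocks eps : 0 < eps ->
  (\int[lebesgue_measure]_(u in `]0%R, +oo[) (u^-1 * Lambda d mu g u)%:E = +oo)%E ->
  {ae P, forall om, forall K, exists2 k, (K <= k)%N &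
     lambda1 (fun e => W e om) (2 ^ k.+2) <= (2 * d)%:R * (eps * g (2 ^+ k.+2))}.
Proof.
move=> eps0 /(dyadic_sum_unbounded d0 q01 qd) unb.
have [c hc] := rate_decay eps0; have [k0 hk0] := pow2_ge u0.
pose blk k := [seq (star x, eps * g (2 ^+ k.+2)) | x <- sites d k].
have bE K M : map fst (flatten [seq blk k | k <- index_iota K M]) =
    map (@star d) (flatten [seq sites d k | k <- index_iota K M]).
  rewrite !map_flatten -!map_comp; congr flatten; apply: eq_map => k /=.
  by rewrite -map_comp.
have := @blocks_infinitely_often _ _ _ _ P W mu mW lawW indW blk; case=> [K M||A [mA PA sA]].
- by rewrite bE; apply: stars_uniq.
- move=> K B; pose K' := maxn K k0.
  (* By the choice of [c], the expected number of closed stars at a large scale [k] is at least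
     [2^(-(c+2)d)] times [Lambda] at [2^(k+c+2)]; hence the shift and the factor. *)
  have [M hM] := unb (K' + (c + 2))%N (2 ^+ ((c + 2) * d) * B).
  exists (maxn K' M).
  have pos k : 0 <= \sum_(r <- blk k) block_prob mu r.
    by apply: sumr_ge0 => r _; rewrite exprn_ge0 ?cdfmu_ge0.
  rewrite (big_cat_nat (n := K')) ?leq_maxl //=.
  apply: le_trans (_ : \sum_(K' <= k < maxn K' M) \sum_(r <- blk k) block_prob mu r <= _);
    last by rewrite lerDr sumr_ge0.
  rewrite -(ler_pM2l (two_gt0 ((c + 2) * d))); apply: le_trans hM _.
  apply: le_trans (_ : \sum_(K' + (c + 2) <= k < maxn K' M + (c + 2))
      (2 ^+ k) ^+ d * q (2 ^+ k) ^+ (2 * d) <= _).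
    have [MK|KM] := leqP M (K' + (c + 2)).
      by rewrite big_geq // sumr_ge0 // => k _; rewrite mulr_ge0 ?exprn_ge0 // cdfmu_ge0.
    rewrite [leRHS](big_cat_nat (n := M)) ?(ltnW KM) //=; last first.
      by apply: leq_trans (leq_maxr K' M) (leq_addr _ _).
    by rewrite lerDl sumr_ge0 // => k _; rewrite mulr_ge0 ?exprn_ge0 // cdfmu_ge0.
  rewrite big_addn addnK mulr_sumr big_nat_cond [leRHS]big_nat_cond.
  apply: ler_sum => k /andP[/andP[K'k _] _].
  rewrite big_map (eq_bigr (fun=> cdfmu mu (eps * g (2 ^+ k.+2)) ^+ (2 * d))); last first.
    by move=> x _; rewrite /block_prob /= size_star.
  rewrite big_const_seq count_predT iter_addr_0 size_sites -[X in _ <= _ * X]mulr_natl [leRHS]mulrA.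
  have -> : (2 : R) ^+ (k + (c + 2)) ^+ d = 2 ^+ ((c + 2) * d) * ((2 ^ k) ^ d)%:R.
    by rewrite !natrX -!exprM -exprD -mulnDl [(k + _)%N]addnC.
  rewrite ler_wpM2l ?mulr_ge0 ?exprn_ge0 //.
  rewrite lerXn2r ?nnegrE ?cdfmu_ge0 //; apply: cdfmu_le.
  rewrite (_ : (k + (c + 2) = c + k.+2)%N); last by lia.
  rewrite exprD; apply: hc; apply: hk0.
  by apply: leq_trans (leq_maxr K k0) (leq_trans K'k _); lia.
exists A; split=> // om h; apply: sA => h'; apply: h => K.
have [k Kk /hasP[r /mapP[x xk ->] cl]] := h' K.
exists k => //; apply: le_trans (lambda1_le_star (fun e => W0 e om) (sites_in_box xk)) _.
apply: le_trans (_ : \sum_(e <- star x) eps * g (2 ^+ k.+2) <= _).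
  by rewrite big_seq [leRHS]big_seq; apply: ler_sum => e ex; apply: (allP cl).
by rewrite big_const_seq count_predT iter_addr_0 size_star mulr_natl.
Qed.

Lemma divergent_case :
  (\int[lebesgue_measure]_(u in `]0%R, +oo[) (u^-1 * Lambda d mu g u)%:E = +oo)%E ->
  {ae P, forall om,
     limn_einf (fun n => (lambda1 (fun e => W e om) n / g n%:R)%:E) = 0%E}.
Proof.
move=> inf.
have dr : 0 < (2 * d)%:R :> R by rewrite ltr0n muln_gt0.
(* The [2d] cancels the number of edges of a star, leaving the bound [1/(i+1)]. *)
pose eps (i : nat) : R := ((2 * d)%:R * i.+1%:R)^-1.
have eps0 i : 0 < eps i by rewrite invr_gt0 mulr_gt0.
have := @ae_foralln _ _ _ P (fun i om => forall K, exists2 k, (K <= k)%N &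
     lambda1 (fun e => W e om) (2 ^ k.+2) <= (2 * d)%:R * (eps i * g (2 ^+ k.+2))).
move=> /(_ (fun i => trap_blocks (eps0 i) inf)).
case=> A [mA PA sA]; exists A; split=> // om h; apply: sA => h'; apply: h => /=.
set u := (fun n : nat => _).
have un0 n : (0 < n)%N -> (0 <= u n)%E.
  by move=> n0; rewrite lee_fin divr_ge0 ?lambda1_ge0 // ltW // g0 // ltr0n.
rewrite limn_einf_lim.
(* Index [0] is left out because [g 0] is unconstrained. *)
suff E : forall n, (0 < n)%N -> einfs u n = 0%E.
  apply/cvg_lim => //; apply: cvg_near_cst; by exists 1%N.
move=> n n0; apply/eqP; rewrite eq_le; apply/andP; split; last first.
  by apply: le_ereal_inf_tmp => _ [k /= nk <-]; apply: un0; apply: leq_trans nk.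
apply/lee_addgt0Pr => e e0; rewrite add0e.
have [i hi] : exists i : nat, e^-1 < i.+1%:R.
  by exists (Num.truncn e^-1); rewrite truncnS_gt.
have [k nk hk] := h' i n.
have gk : 0 < g (2 ^+ k.+2) by apply: g0.
apply: le_trans (_ : u (2 ^ k.+2)%N <= _)%E.
  apply: ereal_inf_lbound; exists (2 ^ k.+2)%N => //=.
  by apply: leq_trans nk _; apply: leq_trans (ltnW (ltn_expl _ (ltnSn 1))) _; rewrite leq_exp2l //; lia.
rewrite lee_fin ler_pdivrMr ?natrX //; apply: le_trans hk _.
rewrite mulrA ler_wpM2r ?(ltW gk) // /eps invfM mulrA divff ?gt_eqF // mul1r.
by rewrite invf_ple ?posrE // ltW.
Qed.

(** * Convergent case *)

(** The half-lines up to [1/(n+1)] decrease to the nonpositive one, which has no mass since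
    conductances are positive; [mu] is continuous along them. *)
Lemma small_level (eps : R) : 0 < eps -> exists2 xi, 0 < xi & cdfmu mu xi <= eps.
Proof.
move=> eps0; pose F n : set R := `]-oo, (n.+1%:R^-1)]%classic.
have cap : \bigcap_n F n = `]-oo, 0%R]%classic.
  apply/seteqP; split=> x /=; rewrite ?in_itv /=.
    move=> h; rewrite leNgt; apply/negP => x0.
    pose n := Num.truncn x^-1.
    have hn : x^-1 < n.+1%:R by rewrite truncnS_gt.
    have := h n I; rewrite /F /= in_itv /= leNgt => /negP; apply.
    by rewrite invf_plt ?posrE.
  by move=> x0 n _; rewrite /F /= in_itv /=; apply: le_trans x0 _; rewrite invr_ge0.
have mu0 : mu (\bigcap_n F n) = 0%E.
  rewrite cap -(lawW ([ffun=> 0], Ordinal d0)) //.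
  rewrite (_ : _ @^-1` _ = set0) ?measure0 //; apply/seteqP; split=> // om /=.
  by rewrite in_itv /= leNgt W0.
have cvgF : mu (F n) @[n --> \oo] --> mu (\bigcap_n F n).
  apply: nonincreasing_cvg_mu => //.
  - by rewrite -ge0_fin_numE // fin_num_measure //; exact: measurable_itv.
  - by move=> n; apply: measurable_itv.
  - by apply: bigcapT_measurable => n; apply: measurable_itv.
  - apply/nonincreasing_seqP => n; apply/subsetPset => x; rewrite /F /= !in_itv /=.
    by move=> h; apply: le_trans h _; rewrite lef_pV2 ?posrE // ler_nat.
rewrite mu0 in cvgF; apply: contrapT => none.
have : (eps%:E <= limn (fun n => mu (F n)))%E.
  apply: lime_ge; first by apply/cvg_ex; exists 0%E.
  apply: nearW => n; rewrite cdfmuE lee_fin leNgt; apply/negP => /ltW h.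
  by apply: none; exists n.+1%:R^-1; rewrite ?invr_gt0.
by rewrite (cvg_lim _ cvgF) // lee_fin leNgt eps0.
Qed.

Let D : nat := ((2 * (3 ^ d * d)) ^ 2)%N.
Let c0 : nat := (d * 8 ^ d)%N.

Let D1 : (1 <= D)%N.
Proof. by rewrite /D expn_gt0 !muln_gt0 expn_gt0 d0. Qed.

Lemma prob_animals k a m v :
  measurable [set om | has_closed (fun e => W e om <= a) (animals d (2 ^ k.+1) m v)] /\
  (P [set om | has_closed (fun e => (W e om <= a)%R) (animals d (2 ^ k.+1) m v)] <=
    (c0%:R * (2 ^+ k) ^+ d * D%:R ^+ m * cdfmu mu a ^+ v)%:E)%E.
Proof.
have [mA PA] := prob_has_closed mW lawW indW a (@mem_animals_uniq d (2 ^ k.+1) m v).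
split=> //; apply: le_trans PA _; rewrite lee_fin ler_wpM2r ?exprn_ge0 ?cdfmu_ge0 //.
by rewrite -!natrX -!natrM ler_nat size_animals_dyadic.
Qed.

Section Scale.
Variables (xi M : R).
Hypothesis Dxi : (D ^ 2)%:R * cdfmu mu xi <= 4^-1.
Hypothesis LM : forall u, 0 < u -> Lambda d mu g u <= M.

Definition bad_weak k om :=
  has_closed (fun e => W e om <= g (2 ^+ k)) (animals d (2 ^ k.+1) (2 * d) (2 * d)).
Definition bad_medium k om :=
  has_closed (fun e => W e om <= g (2 ^+ k./2))
    (animals d (2 ^ k.+1) (4 * d.+1) (4 * d.+1)).
Definition bad_strong k om :=
  has (fun j => has_closed (fun e => W e om <= xi) (animals d (2 ^ k.+1) j (uphalf j)))
    (index_iota (d.+1 * k) (size (EB d (2 ^ k.+1))).+1).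

(** Order [2^(kd)] starting points and [2d] closed edges reproduce [Lambda] up to a constant. *)
Lemma prob_bad_weak k : measurable [set om | bad_weak k om] /\
  (P [set om | bad_weak k om] <=
    (c0%:R * D%:R ^+ (2 * d) * Lambda d mu g (2 ^+ k))%:E)%E.
Proof.
have [mA PA] := prob_animals k (g (2 ^+ k)) (2 * d) (2 * d).
split=> //; apply: le_trans PA _; rewrite lee_fin /Lambda -/(cdfmu mu _).
by rewrite le_eqVlt; apply/orP; left; apply/eqP; ring.
Qed.

Lemma pos_pow_le (x y : R) n : (0 < n)%N -> 0 <= x -> x ^+ n <= y -> x <= Num.max 1 y.
Proof.
move=> n0 x0 xy; rewrite le_max; have [x1|x1] := leP x 1 => //=.
by apply: le_trans xy; rewrite -[leLHS]expr1 ler_weXn2l // ltW.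
Qed.

(** Boundedness of [Lambda] at [2^(k/2)] makes [p^4] of order [2^(-k)]; [4(d+1)] closed edges then
    give [2^(-k(d+1))], which beats the [2^(kd)] starting points with a summable factor to spare. *)
Lemma prob_bad_medium k : measurable [set om | bad_medium k om] /\
  (P [set om | bad_medium k om] <=
    (c0%:R * D%:R ^+ (4 * d.+1) * (2 * Num.max 1 M ^+ 2) ^+ d.+1 * 2^-1 ^+ k)%:E)%E.
Proof.
have [mA PA] := prob_animals k (g (2 ^+ k./2)) (4 * d.+1) (4 * d.+1).
split=> //; apply: le_trans PA _; rewrite lee_fin.
set p := cdfmu mu _; set M1 := Num.max 1 M; set j := k./2.
have p0 : 0 <= p by apply: cdfmu_ge0.
have M10 : 0 <= M1 by rewrite le_max ler01.
have pj : 2 ^+ j * p ^+ 2 <= M1.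
  apply: (@pos_pow_le _ _ d) => //; first by rewrite mulr_ge0 ?exprn_ge0.
  by rewrite exprMn -(exprM p); apply: LM.
have kj : (2 : R) ^+ k <= 2 * (2 ^+ j) ^+ 2.
  rewrite -exprM -exprS ler_weXn2l ?ler1n //.
  by rewrite /j; have := odd_double_half k; case: odd; lia.
have p4 : 2 ^+ k * p ^+ 4 <= 2 * M1 ^+ 2.
  apply: le_trans (_ : 2 * (2 ^+ j * p ^+ 2) ^+ 2 <= _).
    have -> : 2 * (2 ^+ j * p ^+ 2) ^+ 2 = 2 * (2 ^+ j) ^+ 2 * p ^+ 4 by ring.
    by apply: ler_wpM2r; rewrite ?exprn_ge0.
  by rewrite ler_wpM2l // lerXn2r ?nnegrE ?mulr_ge0 ?exprn_ge0.
have pd : 2 ^+ k ^+ d.+1 * p ^+ (4 * d.+1) <= (2 * M1 ^+ 2) ^+ d.+1.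
  by rewrite exprM -exprMn lerXn2r ?nnegrE ?mulr_ge0 ?exprn_ge0.
rewrite -mulrA [_ ^+ (4 * d.+1) * _]mulrC mulrA.
have -> : c0%:R * (2 ^+ k) ^+ d * p ^+ (4 * d.+1) * D%:R ^+ (4 * d.+1) =
  c0%:R * D%:R ^+ (4 * d.+1) * (2 ^+ k ^+ d.+1 * p ^+ (4 * d.+1)) * 2^-1 ^+ k.
  rewrite exprVn [2 ^+ k ^+ d.+1]exprS; field; by rewrite expf_neq0.
by rewrite ler_wpM2r ?exprn_ge0 ?invr_ge0 // ler_wpM2l.
Qed.

(** Each closed edge pays for two growth factors: [D^2 * cdfmu mu xi <= 1/4], to the power [j/2]
    rounded up. *)
Lemma strong_term j : D%:R ^+ j * cdfmu mu xi ^+ uphalf j <= 2^-1 ^+ j.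
Proof.
have ju : (j <= uphalf j * 2)%N by rewrite muln2 -leq_uphalf_double.
apply: le_trans (_ : D%:R ^+ (uphalf j * 2) * cdfmu mu xi ^+ uphalf j <= _).
  by rewrite ler_wpM2r ?exprn_ge0 ?cdfmu_ge0 // ler_weXn2l // ler1n.
rewrite mulnC exprM -exprMn.
apply: le_trans (_ : (4^-1) ^+ uphalf j <= _).
  rewrite lerXn2r ?nnegrE ?invr_ge0 ?mulr_ge0 ?exprn_ge0 ?cdfmu_ge0 //.
  by move: Dxi; rewrite natrX.
have -> : (4 : R)^-1 = 2^-1 ^+ 2 by rewrite exprVn -natrX.
by rewrite -exprM ler_wiXn2l ?invr_ge0 ?invf_le1 ?ler1n //; lia.
Qed.

(** The geometric tail from [(d+1)k] on is of order [2^(-(d+1)k)]; the [2^(kd)] starting points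
    leave [2^(-k)]. *)
Lemma prob_bad_strong k : measurable [set om | bad_strong k om] /\
  (P [set om | bad_strong k om] <= (2 * c0%:R * 2^-1 ^+ k)%:E)%E.
Proof.
have [||mA PA] := @union_bound R dT T P nat
  (index_iota (d.+1 * k) (size (EB d (2 ^ k.+1))).+1)
  (fun j om => has_closed (fun e => W e om <= xi) (animals d (2 ^ k.+1) j (uphalf j)))
  (fun j => c0%:R * (2 ^+ k) ^+ d * 2^-1 ^+ j).
- by move=> j; have [] := prob_animals k xi j (uphalf j).
- move=> j _; have [_] := prob_animals k xi j (uphalf j); move/le_trans; apply.
  by rewrite lee_fin -mulrA ler_wpM2l ?mulr_ge0 ?exprn_ge0 // strong_term.
split=> //; apply: le_trans PA _; rewrite lee_fin -mulr_sumr.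
apply: le_trans (_ : c0%:R * (2 ^+ k) ^+ d * (2 * 2^-1 ^+ (d.+1 * k)) <= _).
  by rewrite ler_wpM2l ?mulr_ge0 ?exprn_ge0 // sum_half_powers.
rewrite !exprVn mulnC exprM [2 ^+ k ^+ d.+1]exprS le_eqVlt; apply/orP; left; apply/eqP.
by field; rewrite !expf_neq0.
Qed.

Definition bad k om := [|| bad_weak k om, bad_medium k om | bad_strong k om].

Lemma prob_bad : exists2 A, 0 <= A & forall k,
  measurable [set om | bad k om] /\
  (P [set om | bad k om] <= (A * (Lambda d mu g (2 ^+ k) + 2^-1 ^+ k))%:E)%E.
Proof.
pose A1 : R := c0%:R * D%:R ^+ (2 * d).
pose A2 : R := c0%:R * D%:R ^+ (4 * d.+1) * (2 * Num.max 1 M ^+ 2) ^+ d.+1.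
pose A3 : R := 2 * c0%:R.
have A10 : 0 <= A1 by rewrite mulr_ge0 ?exprn_ge0.
have A20 : 0 <= A2.
  by rewrite mulr_ge0 ?exprn_ge0 ?mulr_ge0 ?exprn_ge0 // le_max ler01.
have A30 : 0 <= A3 by rewrite mulr_ge0.
exists (A1 + A2 + A3); first by rewrite !addr_ge0.
move=> k; have [m1 P1] := prob_bad_weak k; have [m2 P2] := prob_bad_medium k.
have [m3 P3] := prob_bad_strong k.
have -> : [set om | bad k om] = [set om | bad_weak k om] `|`
   ([set om | bad_medium k om] `|` [set om | bad_strong k om]).
  apply/seteqP; split=> om /=; first by move=> /or3P[]; [left|right; left|right; right].
  by rewrite /bad => -[->|[->|->]]; rewrite ?orbT.
have m23 := measurableU _ _ m2 m3; split; first exact: measurableU.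
apply: le_trans (measureU2 _ m1 m23) _.
apply: le_trans (leeD P1 (le_trans (measureU2 _ m2 m3) (leeD P2 P3))) _.
rewrite -!EFinD lee_fin -/A1 -/A2 -/A3.
have L0 : 0 <= Lambda d mu g (2 ^+ k).
  by rewrite mulr_ge0 ?exprn_ge0 // cdfmu_ge0.
have h0 : 0 <= (2^-1 : R) ^+ k by rewrite exprn_ge0 ?invr_ge0.
move: (Lambda _ _ _ _) (2^-1 ^+ k) L0 h0 => x y x0 y0; nra.
Qed.

(** The first Borel-Cantelli lemma; finiteness of the integral makes the dyadic sum of [Lambda]
    converge. *)
Lemma bad_finitely_often :
  (\int[lebesgue_measure]_(u in `]0%R, +oo[) (u^-1 * Lambda d mu g u)%:E < +oo)%E ->
  exists2 Z, measurable Z /\ P Z = 0%E & forall om, ~ Z om ->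
    exists k0, forall k, (k0 <= k)%N -> ~~ bad k om.
Proof.
move=> /(dyadic_sum_bounded d0 q01 qd)[B hB]; have [A A0 hA] := prob_bad.
pose F k := [set om | bad k om]; exists (lim_sup_set F); last first.
  move=> om h; apply: contrapT => /forallNP hk; apply: h => k0 _.
  have /existsNP[k /not_implyP[kk /negP]] := hk k0; rewrite negbK => bk.
  by exists k.
split.
  apply: bigcapT_measurable => n; apply: bigcup_measurable => k _; exact: (hA k).1.
apply: lim_sup_set_cvg0; first by move=> k; exact: (hA k).1.
apply: le_lt_trans (_ : (A * (B + 2))%:E < +oo)%E; last by rewrite ltry.
apply: lime_le; first by apply: is_cvg_nneseries => k _ _; apply: measure_ge0.
apply: nearW => n.
apply: le_trans (_ : \sum_(0 <= k < n) (A * (Lambda d mu g (2 ^+ k) + 2^-1 ^+ k))%:E <= _)%E.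
  by apply: lee_sum => k _; exact: (hA k).2.
rewrite sumEFin lee_fin -mulr_sumr ler_wpM2l // big_split /= lerD //.
by apply: le_trans (sum_half_powers R 0 n) _; rewrite expr0 mulr1.
Qed.

End Scale.

Lemma scale_constants xi : 0 < xi -> exists A k0, 0 < A /\ forall k, (k0 <= k)%N ->
  let k1 := (4 * d.+1)%N in let m := (d.+1 * k)%N in let L := (k1 ^ d + m ^ d)%N in
  [/\ (0 < k)%N, (m ^ d + L.*2.+1 ^ d * m <= 2 ^ k.+1)%N &
   2 * (4 * d * (8 * 2 ^ k.+1) ^ 2)%:R / xi
     + 4 * ((k1 ^ d) ^ 2 * (k1 ^ d).*2.+1 ^ d)%:R / g (2 ^+ k)
     + 4 * (L ^ 2 * L.*2.+1 ^ d)%:R / g (2 ^+ k./2) <= A / g (2 ^+ k)].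
Proof.
move=> xi0; have [ka hka] := gap_numerics (4 * d.+1) d0; have [kb hkb] := pow2_ge u0.
pose Kc : R := (((4 * d.+1) ^ d) ^ 2 * ((4 * d.+1) ^ d).*2.+1 ^ d)%:R.
pose C1 : R := C * (u0 ^+ 2 * g u0); pose E1 : R := (4 * d * 16 ^ 2)%:R.
have C10 : 0 < C1 by rewrite mulr_gt0 // mulr_gt0 ?exprn_gt0 // g0.
have E10 : 0 <= E1 by apply: ler0n.
have Kc0 : 0 <= Kc by apply: ler0n.
have B0 : 0 <= 2 * E1 / xi by rewrite divr_ge0 ?mulr_ge0 // ltW.
exists (2 * E1 / xi * C1 + 4 * Kc + 4 * C), (ka + kb.*2 + 1)%N; split.
  have : 0 <= 2 * E1 / xi * C1 by rewrite mulr_ge0 // ltW.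
  by move=> h; rewrite ltr_wpDl ?mulr_gt0 // addr_ge0 // mulr_ge0.
move=> k hk k1 m L.
have [ka1 kb0 kbh hk2 k0] : [/\ (ka <= k)%N, (kb <= k)%N, (kb <= k./2)%N,
    (k./2 * 2 <= k)%N & (0 < k)%N].
  clear -hk; have := odd_double_half k; case: odd; split; lia.
have k2k : (k./2 <= k)%N by apply: leq_trans hk2; rewrite leq_pmulr.
have [n1 n2] := hka k ka1.
have kb1 : u0 <= 2 ^+ k by apply: hkb.
have kb2 : u0 <= 2 ^+ k./2 by apply: hkb.
have kk : (2 : R) ^+ k./2 <= 2 ^+ k by rewrite ler_weXn2l ?ler1n.
have s0 : 0 < g (2 ^+ k) by apply: g0.
have t0 : 0 < g (2 ^+ k./2) by apply: g0.
split; first by [].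
  by apply: leq_trans n1 _; rewrite leq_exp2l.
(* Growth from the fixed point [u0] handles the [N^2] of the Cheeger term. *)
have h1 : (2 ^+ k) ^+ 2 * g (2 ^+ k) <= C1 by apply: growth.
(* Growth from [2^(k/2)], whose square is at most [2^k], gains a full factor [2^k], which swallows
   the polylogarithmic term in [L]. *)
have h2 : 2 ^+ k * g (2 ^+ k) <= C * g (2 ^+ k./2).
  have := growth kb2 kk => h; rewrite -(ler_pM2l (two_gt0 k)) mulrA -expr2.
  apply: le_trans h _; rewrite [leRHS]mulrCA ler_wpM2l ?(ltW C0) // ler_wpM2r ?(ltW t0) //.
  by rewrite -exprM ler_weXn2l ?ler1n.
rewrite [leRHS]mulrDl [X in _ <= X + _]mulrDl; apply: lerD; first apply: lerD.
- rewrite ler_pdivlMr //.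
  have -> : (4 * d * (8 * 2 ^ k.+1) ^ 2 = 4 * d * 16 ^ 2 * (2 ^ k) ^ 2)%N.
    by rewrite -[RHS]mulnA -expnMn [(2 ^ k.+1)%N]expnS [(8 * _)%N]mulnA.
  rewrite natrM -/E1 !natrX.
  have -> (a b x y : R) : 2 * (a * b) / x * y = 2 * a / x * (b * y).
    by rewrite -!mulrA [b * _]mulrCA.
  exact: ler_wpM2l.
- by [].
- rewrite ler_pdivrMr // mulrAC ler_pdivlMr //.
  rewrite -[leLHS]mulrA -[leRHS]mulrA ler_wpM2l //; apply: le_trans h2.
  by rewrite ler_wpM2r ?(ltW s0) // -natrX ler_nat.
Qed.

Lemma convergent_case :
  (\int[lebesgue_measure]_(u in `]0%R, +oo[) (u^-1 * Lambda d mu g u)%:E < +oo)%E ->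
  (exists M : R, forall u, 0 < u -> Lambda d mu g u <= M) ->
  exists c : R, 0 < c /\
    {ae P, forall om, \forall n \near \oo,
       c * g n%:R <= lambda1 (fun e => W e om) n}.
Proof.
move=> int [M hM].
have D20 : 0 < (D ^ 2)%:R :> R by rewrite ltr0n expn_gt0 D1.
have [xi xi0 hxi] : exists2 xi, 0 < xi & cdfmu mu xi <= (4 * (D ^ 2)%:R)^-1.
  by apply: small_level; rewrite invr_gt0 mulr_gt0.
have Dxi : (D ^ 2)%:R * cdfmu mu xi <= 4^-1.
  rewrite -(ler_pM2l D20) invfM mulrCA divff ?mulr1 ?gt_eqF // in hxi.
have [Z [mZ PZ] hZ] := bad_finitely_often Dxi hM int.
have [A [k0 [A0 hA]]] := scale_constants xi0.
(* The [2] is the loss in [denergy_le_energy]. *)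
exists (2 * A)^-1; split; first by rewrite invr_gt0 mulr_gt0.
exists Z; split=> // om; apply: contra_notP => /hZ[k1 hk1].
exists (2 ^ (k0 + k1))%N => // n /= hn.
(* Round [n] down to a power of two: [B_n] lies in the box of radius [2^(k+1)], and
   [g n <= g (2^k)]. *)
pose k := trunc_log 2 n.
have n0 : (0 < n)%N by apply: leq_trans hn; rewrite expn_gt0.
have /andP[kn nk] := trunc_log_bounds (ltnSn 1) n0.
have kk : (k0 + k1 <= k)%N by apply: trunc_log_max.
have [k_gt0 num1 num2] := hA k (leq_trans (leq_addr _ _) kk).
have := hk1 k (leq_trans (leq_addl _ _) kk); rewrite !negb_or => /and3P[b1 b2 b3].
apply: lambda1_ge => f fn f1.
have w0 e : 0 < (W^~ om) e by apply: W0.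
have N0 : (0 < 2 ^ k.+1)%N by rewrite expn_gt0.
have fN x : ~~ in_box (2 ^ k.+1) x -> f x = 0.
  by move=> h; apply: fn; apply: contra h; apply: in_box_le; apply: ltnW.
have s0 : 0 < g (2 ^+ k) by apply: g0.
have t0 : 0 < g (2 ^+ k./2) by apply: g0.
have strong j : (d.+1 * k <= j <= size (EB d (2 ^ k.+1)))%N ->
   ~~ has_closed (fun e => W e om <= xi) (animals d (2 ^ k.+1) j (uphalf j)).
  move=> hj; apply: contra b3 => h; apply/hasP; exists j => //.
  by rewrite mem_index_iota ltnS.
have gap := @spectral_gap R d (W^~ om) w0 (2 ^ k.+1) xi (g (2 ^+ k./2)) (g (2 ^+ k))
  (d.+1 * k) (4 * d.+1) f d2 N0 _ _ xi0 t0 s0 num1 strong b2 b1 fN.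
have {}gap := gap ltac:(by rewrite muln_gt0) ltac:(by []).
have one : 1 <= \sum_(x <- box d (2 ^ k.+1)) f x ^+ 2.
  rewrite -f1; apply: ler_sum_sub; rewrite ?box_uniq //.
    by move=> x; rewrite !mem_box; apply: in_box_le; apply: ltnW.
  by move=> x; rewrite sqr_ge0.
have de := denergy_le_energy w0 (ltnW nk) fn.
have de0 : 0 <= denergy (W^~ om) (2 ^ k.+1) f.
  by apply: sumr_ge0 => e _; apply: (wgrad_ge0 w0).
have gn : g n%:R <= g (2 ^+ k).
  by apply: gd => //; rewrite -natrX ler_nat.
have h : 1 <= A / g (2 ^+ k) * (2 * energy (W^~ om) n f).
  apply: le_trans one _; apply: le_trans gap _.
  apply: le_trans (ler_wpM2r de0 num2) _; rewrite ler_wpM2l // divr_ge0 // ltW //.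
rewrite mulrC ler_pdivrMr ?mulr_gt0 //; apply: le_trans gn _.
by move: h; rewrite mulrAC ler_pdivlMr // mul1r; lra.
Qed.

End Main.

Theorem theorem1p3 (R : realType) (d : nat) (dT : measure_display)
  (T : measurableType dT) (P : probability T R)
  (W : edge d -> T -> R) (mu : probability R R) (g : R -> R) :
  (2 <= d)%N ->
  (* (w_e)_e : i.i.d. (0,oo)-valued random variables with common law mu *)
  (forall e, measurable_fun setT (W e)) ->
  (forall e omega, 0 < W e omega) ->
  (forall e (A : set R), measurable A -> P (W e @^-1` A) = mu A) ->
  mutually_independent P W ->
  (* g : (0,oo) -> (0,oo) decreasing *)
  (forall u, 0 < u -> 0 < g u) ->
  (forall u v, 0 < u -> u <= v -> g v <= g u) ->
  (* (a) or (b) *)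
  ((exists rho, rho < -2 /\ regularly_varying g rho) \/
   (monotone_on_pos (fun u => u ^+ 2 * g u) /\
    exists l : R, (fun u => u ^+ 2 * g u) x @[x --> +oo] --> l)) ->
  (* (1) *)
  (((\int[lebesgue_measure]_(u in `]0%R, +oo[) (u^-1 * Lambda d mu g u)%:E
       < +oo)%E ->
    (exists M : R, forall u, 0 < u -> Lambda d mu g u <= M) ->
    exists c : R, 0 < c /\
      {ae P, forall omega, \forall n \near \oo,
          c * g n%:R <= lambda1 (fun e => W e omega) n})
  /\
  (* (2) *)
   ((\int[lebesgue_measure]_(u in `]0%R, +oo[) (u^-1 * Lambda d mu g u)%:E
       = +oo)%E ->
    {ae P, forall omega,
      limn_einf (fun n => (lambda1 (fun e => W e omega) n / g n%:R)%:E) = 0%E})).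
Proof.
move=> d2 mW W0 lawW indW g0 gd hyp.
have [C [u0 [C0 u00 growth]]] := rate_growth g0 gd hyp.
split; first exact: (convergent_case d2 mW W0 lawW indW g0 gd C0 u00 growth).
exact: (divergent_case d2 mW W0 lawW indW g0 gd C0 u00 growth).
Qed.
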